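(* Up to isomorphism, the indecomposable representations in $\mathrm{rep}_K(\mathcal{Q}_2,I_3)$ are exactly the following $30$ pairwise non-isomorphic representations. Each is of the form $K^i\xrightarrow{e_{i,j}}K^j$ with the loop given by a nilpotent $j\times j$ matrix $N$, where $e_{i,j}$ is the natural embedding (in the case $(i,j)=(1,0)$, the zero map $K\to 0$); the symbol $U_{i,j}$ or $U_{i,j}^{(s)}$ records $(i,j)$. After each name we list the dimension vector of the corresponding indecomposable representation of the covering $(\widehat{\mathcal Q},\widehat I)$ (listed row by row, top to bottom, zero rows deleted), and then $N$, where $E_{a,b}$ is the $j\times j$ matrix unit: 1. $U_{0,1}$: $(0\,1)$; $N=0$. 2. $U_{1,1}$: $(1\,1)$; $N=0$. 3. $U_{1,0}$: $(1\,0)$; $N=0$. 4. $U_{0,2}$: $(0\,1)(0\,1)$; $E_{2,1}$. 5. $U_{1,2}^{(1)}$: $(1\,1)(0\,1)$; $E_{2,1}$. 6. $U_{1,2}^{(2)}$: $(0\,1)(1\,1)$; $E_{1,2}$. 7. $U_{2,2}$: $(1\,1)(1\,1)$; $E_{2,1}$. 8. $U_{0,3}$: $(0\,1)(0\,1)(0\,1)$; $E_{2,1}+E_{3,2}$. 9. $U_{1,3}^{(1)}$: $(1\,1)(0\,1)(0\,1)$; $E_{2,1}+E_{3,2}$. 10. $U_{2,3}^{(1)}$: $(1\,1)(1\,1)(0\,1)$; $E_{2,1}+E_{3,2}$. 11. $U_{1,3}^{(2)}$: $(0\,1)(1\,1)(0\,1)$; $E_{3,1}+E_{1,2}$. 12.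 $U_{2,3}^{(2)}$: $(1\,1)(0\,1)(1\,1)$; $E_{3,1}+E_{2,3}$. 13. $U_{3,3}$: $(1\,1)(1\,1)(1\,1)$; $E_{2,1}+E_{3,2}$. 14. $U_{1,3}^{(3)}$: $(0\,1)(0\,1)(1\,1)$; $E_{1,2}+E_{2,3}$. 15. $U_{2,3}^{(3)}$: $(0\,1)(1\,1)(1\,1)$; $E_{1,2}+E_{2,3}$. 16. $U_{1,4}$: $(0\,1)(1\,2)(0\,1)$; $E_{2,1}+E_{2,3}+E_{3,4}$. 17. $U_{2,4}^{(1)}$: $(1\,1)(1\,2)(0\,1)$; $E_{3,1}+E_{4,2}+E_{4,3}$. 18. $U_{2,4}^{(2)}$: $(0\,1)(1\,2)(1\,1)$; $E_{1,2}+E_{1,3}+E_{3,4}$. 19. $U_{3,4}$: $(1\,1)(1\,2)(1\,1)$; $E_{1,2}+E_{1,4}+E_{4,3}$. 20. $U_{2,5}^{(1)}$: $(1\,2)(1\,2)(0\,1)$; $E_{3,1}+E_{4,2}+E_{3,4}+E_{1,5}$. 21. $U_{2,5}^{(2)}$: $(0\,1)(1\,2)(1\,2)$; $E_{3,2}+E_{1,4}+E_{2,5}+E_{4,5}$. 22. $U_{3,5}^{(1)}$: $(1\,1)(1\,2)(1\,2)$; $E_{4,2}+E_{2,3}+E_{5,3}+E_{1,5}$. 23. $U_{3,5}^{(2)}$: $(1\,2)(1\,2)(1\,1)$; $E_{1,2}+E_{4,3}+E_{1,4}+E_{2,5}$. 24. $U_{2,6}$: $(0\,1)(1\,2)(1\,2)(0\,1)$;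 $E_{1,3}+E_{2,1}+E_{2,4}-E_{4,3}+E_{5,1}+E_{6,2}$. 25. $U_{3,6}$: $(1\,2)(1\,2)(1\,2)$; $E_{1,2}+E_{4,2}+E_{5,3}+E_{4,5}+E_{2,6}-E_{5,6}$. 26. $U_{3,6}^{(1)}$: $(1\,1)(1\,2)(1\,2)(0\,1)$; $E_{2,1}+E_{3,2}+E_{3,4}-E_{4,1}+E_{5,2}+E_{6,3}$. 27. $U_{3,6}^{(2)}$: $(0\,1)(1\,2)(1\,2)(1\,1)$; $E_{2,5}+E_{3,2}+E_{3,6}+E_{5,4}+E_{6,1}-E_{6,5}$. 28. $U_{4,6}$: $(1\,1)(1\,2)(1\,2)(1\,1)$; $E_{2,1}+E_{3,2}+E_{3,5}+E_{4,3}-E_{5,1}+E_{6,2}$. 29. $U_{3,7}$: $(1\,2)(1\,3)(1\,2)$; $E_{1,2}+E_{4,2}-E_{6,3}-E_{1,5}-E_{4,6}-E_{5,7}$. 30. $U_{4,7}$: $(1\,2)(2\,3)(1\,2)$; $E_{5,2}+E_{1,3}+E_{2,4}+E_{6,4}+E_{3,7}+E_{6,7}$.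
   Context: Let $K=\mathbf{C}$. $\mathcal{Q}_2$ is the quiver with vertices $1,2$, one arrow $\alpha_1\colon 1\to 2$ and one loop $\alpha\colon 2\to 2$; $I_3=(\alpha^3)$. $\mathrm{rep}_K(\mathcal{Q}_2,I_3)$ is the category of finite-dimensional $K$-representations $(M_1\xrightarrow{f}M_2,\ \varphi\in\mathrm{End}(M_2))$ with $\varphi^3=0$ ($f$ arbitrary). The natural embedding $e_{i,j}\colon K^i\to K^j$ sends the $k$-th coordinate vector to the $k$-th coordinate vector. The matrix unit $E_{a,b}$ has entry $1$ in row $a$, column $b$, and zeros elsewhere, and matrices act on column vectors. The covering quiver $\widehat{\mathcal Q}$ has vertices $l_r,t_r$ ($r\in\mathbf{Z}$), arrows $l_r\to t_r$ and $t_r\to t_{r+1}$; $\widehat I$ is generated by all paths $t_r\to t_{r+1}\to t_{r+2}\to t_{r+3}$. Row $r$ of a dimension vector is $(\dim \text{ at } l_r,\ \dim\text{ at } t_r)$, with rows listed in increasing order of $r$. The group $\mathbf{Z}$ acts by shifting rows; a representation of $(\widehat{\mathcal Q},\widehat I)$ gives one of $(\mathcal{Q}_2,I_3)$ by taking the direct sum of the spaces at all $l_r$ as the space at vertex $1$ and the direct sum of the spaces at all $t_r$ as the space at vertex $2$. This induces a bijection between isomorphism classes of indecomposables of $(\widehat{\mathcal Q},\widehat I)$ modulo the shift and isomorphism classes of indecomposables of $(\mathcal{Q}_2,I_3)$. *)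

(* Defs.v *)
From HB Require Import structures.
From mathcomp Require Import all_boot all_order all_algebra.
From mathcomp Require Import reals complex.

Set Implicit Arguments.
Unset Strict Implicit.
Unset Printing Implicit Defensive.

Import GRing.Theory.
Local Open Scope ring_scope.

Definition hom_pair (K : fieldType) (U U' V V' : vectType K)
    (g : 'Hom(U, V)) (g' : 'Hom(U', V')) : 'Hom((U * U')%type, (V * V')%type) :=
  linfun (fun x => (g x.1, g' x.2)).

(* [linfun] is meaningful only on linear functions. *)
Lemma hom_pairE (K : fieldType) (U U' V V' : vectType K)
    (g : 'Hom(U, V)) (g' : 'Hom(U', V')) x :
  hom_pair g g' x = (g x.1, g' x.2).
Proof.
pose h (y : U * U') : V * V' := (g y.1, g' y.2).
have h_lin : linear h by move=> a y z; rewrite /h /= !linearP.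
pose hM := GRing.isLinear.Build K (U * U')%type (V * V')%type *:%R h h_lin.
pose hL : {linear (U * U')%type -> (V * V')%type} := HB.pack h hM.
exact: (lfunE hL x).
Qed.

Record rep (K : fieldType) := Rep {
  rsp1 : vectType K;
  rsp2 : vectType K;
  rarr : 'Hom(rsp1, rsp2);
  rloop : 'End(rsp2)
}.

(* M is a representation of the bound quiver (Q_2, I_3). *)
Definition rbound (K : fieldType) (M : rep K) : Prop :=
  forall x, rloop M (rloop M (rloop M x)) = 0.

Definition riso (K : fieldType) (M M' : rep K) : Prop :=
  exists (g1 : 'Hom(rsp1 M, rsp1 M')) (g2 : 'Hom(rsp2 M, rsp2 M')),
    [/\ bijective g1, bijective g2,
        forall x, g2 (rarr M x) = rarr M' (g1 x)
      & forall x, g2 (rloop M x) = rloop M' (g2 x)].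

Definition rzero (K : fieldType) (M : rep K) : Prop :=
  \dim {: rsp1 M} = 0%N /\ \dim {: rsp2 M} = 0%N.

Definition rsum (K : fieldType) (A B : rep K) : rep K :=
  Rep (hom_pair (rarr A) (rarr B)) (hom_pair (rloop A) (rloop B)).

(* If M satisfies the relation, then so do its direct summands A and B: for
   such an M this is indecomposability in rep(Q_2, I_3). *)
Definition rindec (K : fieldType) (M : rep K) : Prop :=
  ~ rzero M /\ forall A B, riso M (rsum A B) -> rzero A \/ rzero B.

(* [clsp X r] and [ctsp X r] are the spaces at l_r and t_r. *)
Record crep (K : fieldType) := CRep {
  clsp : int -> vectType K;
  ctsp : int -> vectType K;
  carr : forall r, 'Hom(clsp r, ctsp r);
  cstep : forall r, 'Hom(ctsp r, ctsp (r + 1))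
}.

Definition cbound (K : fieldType) (X : crep K) : Prop :=
  forall r x, cstep X (r + 1 + 1) (cstep X (r + 1) (cstep X r x)) = 0.

Definition ciso (K : fieldType) (X X' : crep K) : Prop :=
  exists (g : forall r, 'Hom(clsp X r, clsp X' r))
         (h : forall r, 'Hom(ctsp X r, ctsp X' r)),
    [/\ forall r, bijective (g r), forall r, bijective (h r),
        forall r x, h r (carr X r x) = carr X' r (g r x)
      & forall r x, h (r + 1) (cstep X r x) = cstep X' r (h r x)].

Definition czero (K : fieldType) (X : crep K) : Prop :=
  forall r, \dim {: clsp X r} = 0%N /\ \dim {: ctsp X r} = 0%N.

Definition csum (K : fieldType) (A B : crep K) : crep K :=
  @CRep K (fun r => (clsp A r * clsp B r)%type)
          (fun r => (ctsp A r * ctsp B r)%type)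
          (fun r => hom_pair (carr A r) (carr B r))
          (fun r => hom_pair (cstep A r) (cstep B r)).

Definition cindec (K : fieldType) (X : crep K) : Prop :=
  ~ czero X /\ forall A B, ciso X (csum A B) -> czero A \/ czero B.

(* W, with the injections i, is the direct sum of the V r, which vanish outside
   the finite set s; every family v is then finitely supported. *)
Definition is_direct_sum (K : fieldType) (V : int -> vectType K)
    (W : vectType K) (i : forall r, 'Hom(V r, W)) : Prop :=
  exists s : seq int,
    [/\ uniq s,
        forall r, r \notin s -> \dim {: V r} = 0%N
      & bijective (fun v : (forall r, V r) => \sum_(r <- s) i r (v r))].

(* M is, up to isomorphism, the representation of Q_2 obtained from X: the
   direct sum of the spaces at all l_r, resp. at all t_r, with the maps that X
   induces on it. *)
Definition is_pushdown (K : fieldType) (X : crep K) (M : rep K) : Prop :=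
  exists (i : forall r, 'Hom(clsp X r, rsp1 M))
         (j : forall r, 'Hom(ctsp X r, rsp2 M)),
    [/\ is_direct_sum i, is_direct_sum j,
        forall r x, rarr M (i r x) = j r (carr X r x)
      & forall r x, rloop M (j r x) = j (r + 1) (cstep X r x)].

(* The correspondence, modulo the shift, between indecomposables of the covering
   and indecomposables of (Q_2, I_3). *)
Definition corresponds (K : fieldType) (X : crep K) (M : rep K) : Prop :=
  [/\ cbound X, cindec X & is_pushdown X M].

Definition crow (K : fieldType) (X : crep K) (r : int) : nat * nat :=
  (\dim {: clsp X r}, \dim {: ctsp X r}).

(* The nonzero rows of X are the consecutive rows s, starting at some m (the
   list s records the dimension vector modulo the shift). *)
Definition has_dimvec (K : fieldType) (X : crep K) (s : seq (nat * nat)) : Prop :=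
  exists m : int,
    (forall k : nat, crow X (m + k%:Z) = nth (0, 0)%N s k) /\
    (forall r : int, r < m -> crow X r = (0, 0)%N).

Record item (K : fieldType) := Item {
  isrc : nat;
  itgt : nat;
  idimvec : seq (nat * nat);
  iloop : 'M[K]_itgt
}.

Arguments Item {K} (isrc itgt idimvec)%_N iloop%_R.

(* [pid_mx i : 'M_(j, i)] is the matrix of the natural embedding e_{i,j} when
   i <= j, and the empty matrix when (i, j) = (1, 0). *)
Definition item_rep (K : fieldType) (u : item K) : rep K :=
  @Rep K 'cV[K]_(isrc u) 'cV[K]_(itgt u)
       (linfun (mulmx (pid_mx (isrc u) : 'M[K]_(itgt u, isrc u))))
       (linfun (mulmx (iloop u))).

(* Matrix unit, with rows and columns numbered from 1. *)
Definition E (K : fieldType) (n a b : nat) : 'M[K]_n :=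
  \matrix_(x, y) ((x.+1 == a) && (y.+1 == b))%:R.

Arguments E {K n} (a b)%_N.

Section List.

Variable K : fieldType.
Local Notation item := (item K).

Definition U01 : item := Item 0 1 [:: (0,1)] 0.
Definition U11 : item := Item 1 1 [:: (1,1)] 0.
Definition U10 : item := Item 1 0 [:: (1,0)] 0.
Definition U02 : item := Item 0 2 [:: (0,1); (0,1)] (E 2 1).
Definition U12_1 : item := Item 1 2 [:: (1,1); (0,1)] (E 2 1).
Definition U12_2 : item := Item 1 2 [:: (0,1); (1,1)] (E 1 2).
Definition U22 : item := Item 2 2 [:: (1,1); (1,1)] (E 2 1).
Definition U03 : item := Item 0 3 [:: (0,1); (0,1); (0,1)] (E 2 1 + E 3 2).
Definition U13_1 : item := Item 1 3 [:: (1,1); (0,1); (0,1)] (E 2 1 + E 3 2).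
Definition U23_1 : item := Item 2 3 [:: (1,1); (1,1); (0,1)] (E 2 1 + E 3 2).
Definition U13_2 : item := Item 1 3 [:: (0,1); (1,1); (0,1)] (E 3 1 + E 1 2).
Definition U23_2 : item := Item 2 3 [:: (1,1); (0,1); (1,1)] (E 3 1 + E 2 3).
Definition U33 : item := Item 3 3 [:: (1,1); (1,1); (1,1)] (E 2 1 + E 3 2).
Definition U13_3 : item := Item 1 3 [:: (0,1); (0,1); (1,1)] (E 1 2 + E 2 3).
Definition U23_3 : item := Item 2 3 [:: (0,1); (1,1); (1,1)] (E 1 2 + E 2 3).
Definition U14 : item := Item 1 4 [:: (0,1); (1,2); (0,1)]
  (E 2 1 + E 2 3 + E 3 4).
Definition U24_1 : item := Item 2 4 [:: (1,1); (1,2); (0,1)]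
  (E 3 1 + E 4 2 + E 4 3).
Definition U24_2 : item := Item 2 4 [:: (0,1); (1,2); (1,1)]
  (E 1 2 + E 1 3 + E 3 4).
Definition U34 : item := Item 3 4 [:: (1,1); (1,2); (1,1)]
  (E 1 2 + E 1 4 + E 4 3).
Definition U25_1 : item := Item 2 5 [:: (1,2); (1,2); (0,1)]
  (E 3 1 + E 4 2 + E 3 4 + E 1 5).
Definition U25_2 : item := Item 2 5 [:: (0,1); (1,2); (1,2)]
  (E 3 2 + E 1 4 + E 2 5 + E 4 5).
Definition U35_1 : item := Item 3 5 [:: (1,1); (1,2); (1,2)]
  (E 4 2 + E 2 3 + E 5 3 + E 1 5).
Definition U35_2 : item := Item 3 5 [:: (1,2); (1,2); (1,1)]
  (E 1 2 + E 4 3 + E 1 4 + E 2 5).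
Definition U26 : item := Item 2 6 [:: (0,1); (1,2); (1,2); (0,1)]
  (E 1 3 + E 2 1 + E 2 4 - E 4 3 + E 5 1 + E 6 2).
Definition U36 : item := Item 3 6 [:: (1,2); (1,2); (1,2)]
  (E 1 2 + E 4 2 + E 5 3 + E 4 5 + E 2 6 - E 5 6).
Definition U36_1 : item := Item 3 6 [:: (1,1); (1,2); (1,2); (0,1)]
  (E 2 1 + E 3 2 + E 3 4 - E 4 1 + E 5 2 + E 6 3).
Definition U36_2 : item := Item 3 6 [:: (0,1); (1,2); (1,2); (1,1)]
  (E 2 5 + E 3 2 + E 3 6 + E 5 4 + E 6 1 - E 6 5).
Definition U46 : item := Item 4 6 [:: (1,1); (1,2); (1,2); (1,1)]
  (E 2 1 + E 3 2 + E 3 5 + E 4 3 - E 5 1 + E 6 2).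
Definition U37 : item := Item 3 7 [:: (1,2); (1,3); (1,2)]
  (E 1 2 + E 4 2 - E 6 3 - E 1 5 - E 4 6 - E 5 7).
Definition U47 : item := Item 4 7 [:: (1,2); (2,3); (1,2)]
  (E 5 2 + E 1 3 + E 2 4 + E 6 4 + E 3 7 + E 6 7).

Definition Ulist : 30.-tuple item :=
  [tuple U01; U11; U10; U02; U12_1; U12_2; U22; U03; U13_1; U23_1; U13_2; U23_2;
         U33; U13_3; U23_3; U14; U24_1; U24_2; U34; U25_1; U25_2; U35_1; U35_2;
         U26; U36; U36_1; U36_2; U46; U37; U47].

End List.

Definition U (K : fieldType) (k : 'I_30) : rep K := item_rep (tnth (Ulist K) k).

Definition Udimvec (K : fieldType) (k : 'I_30) : seq (nat * nat) :=
  idimvec (tnth (Ulist K) k).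

(* Main.v *)
Require Import Defs.
From HB Require Import structures.
From mathcomp Require Import all_boot all_order all_algebra.
From mathcomp Require Import boolp reals complex.

(** The argument is Auslander's: a finite list of indecomposables that contains
    the projectives and is closed under almost split maps is complete.  All
    thirty representations are treated uniformly, by tables of integers and
    computations with them that are valid over every field.

    The standard basis of each listed representation U is homogeneous for a
    grading by the rows of the covering quiver, and solving the equations
    e N = N e shows that an endomorphism e is a scalar plus terms that strictly
    raise the degree [brick_endo].  Hence the endomorphism ring is local and U is
    indecomposable [brick_indec].

    For the dimension vectors, suppose that X is a representation of the
    covering with push-down U.  The operator D that is multiplication by r on
    the part of degree r satisfies D f = f D and D N = N D + N.  The operator
    D_0 of the standard grading satisfies the same equations, so D - D_0 is an
    endomorphism: D is triangular with diagonal deg + c.  Its eigenvalues are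
    thus the degrees up to a shift, with the same multiplicities, which
    determines the dimension vector of X up to shift [pushdown_dimvec].  The
    thirty dimension vectors are distinct, so the representations are pairwise
    non-isomorphic [U_riso].  Cutting U along the standard grading gives a
    representation of the covering [covering_rep], and a decomposition of it
    would decompose U [pushdown_cindec].

    For completeness, let M be indecomposable and not in the list.  Fix a listed
    U other than K -> 0 and a map g : U -> M.  Whether g extends along the left
    almost split map U -> E is the solvability of a linear system in M.  If it
    is not solvable, a linear functional separates the right-hand side from the
    solvable ones.  This functional assembles to a map h : M -> U, because the
    equations of the system are those that describe U inside its injective
    hull; this is the Auslander-Reiten formula in explicit form.  By
    construction the scalar part of h g is nonzero, so h g is invertible and U
    is a direct summand of M, contrary to the assumption [almost_split_or].
    So g is a sum of composites U -> X -> M with X in the list [arrow_sum].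
    Iterating, g is a sum of arbitrarily long composites, and these are zero:
    every basis vector carries a height that drops at each arrow [all_hom0].
    As any vector of M at the second vertex is the image of the generator of the
    projective K[x]/(x^3) = U_{0,3}, the space at the second vertex is zero, and
    M is K -> 0 after all [classification]. *)

Set Implicit Arguments.
Unset Strict Implicit.
Unset Printing Implicit Defensive.

Import Order.TTheory GRing.Theory Num.Theory.
Local Open Scope ring_scope.

Local Notation nat2 := (nat * nat)%type.

(** * Integer linear forms *)

(** Forms in formal symbols can be computed with, and evaluate in every abelian
    group.  Each linear identity between explicit vectors used below is checked
    once, on forms, and then holds over every field. *)
Definition zform (T : eqType) := seq (T * int).

Definition feval (T : eqType) (V : zmodType) (v : T -> V) (f : zform T) : V :=
  \sum_(p <- f) v p.1 *~ p.2.

Section FormOps.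

Variable T : eqType.
Implicit Types (f g : zform T) (k : T) (x : int).

Fixpoint finsert k x f : zform T :=
  if f is p :: f' then
    if k == p.1 then
      let z := (x + p.2)%R in if z == 0 then f' else (k, z) :: f'
    else p :: finsert k x f'
  else [:: (k, x)].

Definition fmuladd x f g : zform T :=
  foldr (fun p h => finsert p.1 (x * p.2)%R h) g f.

Fixpoint fcoef k f : int :=
  if f is p :: f' then if k == p.1 then p.2 else fcoef k f' else 0.

(** A pair (k, h) in [B] is a row [h] in which the pivot [k] has coefficient 1,
    so that elimination never divides. *)
Definition freduce (B : seq (T * zform T)) f : zform T :=
  foldl (fun h b => let x := fcoef b.1 h in
                    if x == 0 then h else fmuladd (- x)%R b.2 h) (fmuladd 1 f [::]) B.

Definition fpivot f : option (T * int) :=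
  ohead [seq p <- f | (p.2 == 1) || (p.2 == -1)].

(** Hypotheses without a coefficient 1 or -1 after reduction are dropped: the
    test [fentails] is sound but not complete. *)
Definition fechelon (hs : seq (zform T)) : seq (T * zform T) :=
  foldl (fun B h =>
    let r := freduce B h in
    if fpivot r is Some p then rcons B (p.1, fmuladd p.2 r [::]) else B) [::] hs.

Definition fentails (hs gs : seq (zform T)) : bool :=
  let B := fechelon hs in all (fun g => nilp (freduce B g)) gs.

End FormOps.

Definition fsubst (T T' : eqType) (s : T -> zform T') (f : zform T) : zform T' :=
  foldr (fun p h => fmuladd p.2 (s p.1) h) [::] f.

Section FormTheory.

Variables (T : eqType) (V : zmodType) (v : T -> V).
Implicit Types (f g : zform T) (k : T) (x : int).

Lemma feval0 : feval v [::] = 0. Proof. by rewrite /feval big_nil. Qed.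

Lemma feval_cons p f : feval v (p :: f) = v p.1 *~ p.2 + feval v f.
Proof. by rewrite /feval big_cons. Qed.

Lemma feval1 k : feval v [:: (k, 1)] = v k.
Proof. by rewrite feval_cons feval0 addr0. Qed.

Lemma feval_cat f g : feval v (f ++ g) = feval v f + feval v g.
Proof. by rewrite /feval big_cat. Qed.

Lemma feval_insert k x f : feval v (finsert k x f) = v k *~ x + feval v f.
Proof.
elim: f => [|p f IH] /=; first by rewrite feval_cons.
case: (k =P p.1) => [->|_]; last by rewrite !feval_cons IH addrCA.
rewrite feval_cons addrA -mulrzDr.
by case: (x + p.2 =P 0) => [->|_]; rewrite ?mulr0z ?add0r ?feval_cons.
Qed.

Lemma feval_muladd x f g : feval v (fmuladd x f g) = feval v f *~ x + feval v g.
Proof.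
elim: f => [|p f IH] /=; first by rewrite feval0 mul0rz add0r.
by rewrite feval_insert IH feval_cons mulrzDl addrA mulrC mulrzA.
Qed.

End FormTheory.

Lemma feval_subst (T T' : eqType) (V : zmodType) (v : T' -> V)
    (s : T -> zform T') f :
  feval v (fsubst s f) = feval (fun k => feval v (s k)) f.
Proof.
elim: f => [|p f IH] /=; first by rewrite !feval0.
by rewrite feval_muladd IH [RHS]feval_cons.
Qed.

Lemma eq_feval (T : eqType) (V : zmodType) (v v' : T -> V) (f : zform T) :
  (forall p, p \in f -> v p.1 = v' p.1) -> feval v f = feval v' f.
Proof. by move=> e; rewrite /feval; apply: eq_big_seq => p /e ->. Qed.

Lemma raddf_feval (T : eqType) (V W : zmodType) (v : T -> V)
    (h : {additive V -> W}) (f : zform T) :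
  h (feval v f) = feval (h \o v) f.
Proof.
by rewrite /feval raddf_sum; apply: eq_bigr => p _; rewrite raddfMz.
Qed.

Section Entailment.

Variables (T : eqType) (K : fieldType) (V : vectType K) (v : T -> V).
Variable H : {vspace V}.

Let holds (f : zform T) := feval v f \in H.

Lemma reduce_sound (B : seq (T * zform T)) f :
    (forall b, b \in B -> holds b.2) -> holds (freduce B f) = holds f.
Proof.
rewrite /freduce /holds => hB.
have -> : (feval v f \in H) = (feval v (fmuladd 1 f [::]) \in H).
  by rewrite feval_muladd feval0 addr0.
elim: B (fmuladd 1 f [::]) hB => [|b B IH] g hB //=.
rewrite IH => [|c cB]; last by apply: hB; rewrite inE cB orbT.
case: eqP => // _; rewrite feval_muladd rpredDl //.
by rewrite rpredMz // hB ?mem_head.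
Qed.

(** Reduction only subtracts multiples of consequences of [hs], which does not
    affect membership in a subspace that contains the values of [hs]. *)
Lemma entails_sound hs gs :
    fentails hs gs -> (forall h, h \in hs -> holds h) ->
  forall g, g \in gs -> holds g.
Proof.
move=> /allP es hH g /es.
suff hB : forall b, b \in fechelon hs -> holds b.2.
  by rewrite -(reduce_sound g hB) => /nilP ->; rewrite /holds feval0 mem0v.
rewrite /fechelon; have: forall b, b \in ([::] : seq (T * zform T)) -> holds b.2 by [].
elim: hs [::] hH {es} => [|h hs IH] B hH hB //=.
apply: IH => [g' g'hs|]; first by apply: hH; rewrite inE g'hs orbT.
have: holds (freduce B h) by rewrite reduce_sound // hH ?mem_head.
case: (fpivot _) => // p hr b; rewrite mem_rcons inE => /orP[/eqP ->|/hB //].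
by rewrite /holds /= feval_muladd feval0 addr0 rpredMz.
Qed.

End Entailment.

Lemma entails_eq0 (T : eqType) (K : fieldType) (V : vectType K) (v : T -> V)
    hs gs :
    fentails hs gs -> (forall h, h \in hs -> feval v h = 0) ->
  forall g, g \in gs -> feval v g = 0.
Proof.
move=> e hH g gs_g; apply/eqP; rewrite -memv0.
by apply: (entails_sound e) gs_g => h /hH ->; rewrite mem0v.
Qed.

(** * Linear maps *)

Section Linear.

Variable K : fieldType.
Implicit Types V W : vectType K.

(** The map e - c is nilpotent.  Stated pointwise, so as to make sense on the
    zero space, where every c qualifies. *)
Definition sole_eigenvalue V (e : 'End(V)) (c : K) :=
  exists m, forall x, iter m (fun y => e y - c *: y) x = 0.

(** On an eigenvector, e - c acts as the scalar a - c, which has to be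
    nilpotent. *)
Lemma sole_eigenvalue_uniq V (e : 'End(V)) c a x :
  sole_eigenvalue e c -> e x = a *: x -> x != 0 -> a = c.
Proof.
move=> [m em] ex x0; apply/eqP; rewrite -subr_eq0.
have it n : iter n (fun y => e y - c *: y) x = (a - c) ^+ n *: x.
  elim: n => [|n IH] /=; first by rewrite scale1r.
  rewrite IH linearZ /= ex !scalerA -scalerBl exprSr.
  by rewrite [c * _]mulrC -mulrBr.
have /eqP := em x; rewrite it scaler_eq0 (negPf x0) orbF.
by rewrite expf_eq0 => /andP[].
Qed.

Lemma sole_eigenvalue_inj V (e : 'End(V)) c x :
  sole_eigenvalue e c -> c != 0 -> e x = 0 -> x = 0.
Proof.
move=> ec c0 ex; apply: contraNeq c0 => x0.
by rewrite -(sole_eigenvalue_uniq (a := 0) ec _ x0) // ex scale0r.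
Qed.

Lemma sole_eigenvalue_idem1 V (e : 'End(V)) c :
  sole_eigenvalue e c -> (forall x, e (e x) = e x) -> c != 0 -> forall x, e x = x.
Proof.
move=> ec ee c0 x; apply/eqP; rewrite -subr_eq0; apply/eqP.
by apply: (sole_eigenvalue_inj ec c0); rewrite linearB /= ee subrr.
Qed.

Lemma sole_eigenvalue_idem0 V (e : 'End(V)) c :
  sole_eigenvalue e c -> (forall x, e (e x) = e x) -> c != 1 -> forall x, e x = 0.
Proof.
move=> ec ee c1 x; apply: contraNeq c1 => ex.
by rewrite -(sole_eigenvalue_uniq (a := 1) ec _ ex) // ee scale1r.
Qed.

Lemma dim_eq0P V : \dim {: V} = 0%N <-> forall x : V, x = 0.
Proof.
split=> [/eqP|V0].
  by rewrite dimv_eq0 => /eqP V0 x; apply/eqP; rewrite -memv0 -V0 memvf.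
apply/eqP; rewrite dimv_eq0; apply/eqP/vspaceP => x.
by rewrite memvf (V0 x) mem0v.
Qed.

Lemma inj_end_inverse V (e : 'End(V)) :
  (forall x, e x = 0 -> x = 0) -> cancel e (e^-1)%VF /\ cancel (e^-1)%VF e.
Proof.
move=> e_inj.
have k0 : lker e == 0%VS.
  apply/eqP/vspaceP => x; rewrite memv0 memv_ker.
  by apply/eqP/eqP => [ex|x0]; [exact: e_inj|rewrite x0 linear0].
split; first exact: (lker0_lfunK k0).
exact: (lker0_lfunVK k0).
Qed.

Lemma bij_lfun_inverse V W (g : 'Hom(V, W)) :
  bijective g -> cancel g (g^-1)%VF /\ cancel (g^-1)%VF g.
Proof.
move=> g_bij.
have k0 : lker g == 0%VS.
  apply/eqP/vspaceP => x; rewrite memv0 memv_ker.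
  by apply/eqP/eqP => [gx|x0]; [apply: (bij_inj g_bij)|]; rewrite ?gx ?x0 linear0.
split; first exact: lker0_lfunK.
by move=> w; have [g' K1 K2] := g_bij; rewrite -{1}(K2 w) lker0_lfunK ?K2.
Qed.

Lemma linear_lfun V W (h : V -> W) : linear h -> exists g : 'Hom(V, W), g =1 h.
Proof.
move=> h_lin.
pose hM := GRing.isLinear.Build K V W *:%R h h_lin.
pose hL : {linear V -> W} := HB.pack h hM.
by exists (linfun hL) => x; rewrite lfunE.
Qed.

(** Some coordinate of the component of y in a complement of U is nonzero. *)
Lemma separating_functional W (U : {vspace W}) (y : W) :
  y \notin U -> exists u : 'Hom(W, K^o), u y != 0 /\ forall x, x \in U -> u x = 0.
Proof.
move=> yU; set y' := y - projv U y.
have y'0 : y' != 0.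
  by apply: contra yU; rewrite subr_eq0 => /eqP ->; apply: memv_proj.
pose X := vbasis {: W}.
have /existsP[i yi] : [exists i, coord X i y' != 0].
  apply: contraR y'0; rewrite negb_exists => /forallP all0.
  rewrite (coord_vbasis (memvf y')) big1 // => i _.
  by have := all0 i; rewrite negbK => /eqP ->; rewrite scale0r.
have [u uE] : exists u : 'Hom(W, K^o), u =1 (fun x => coord X i (x - projv U x)).
  by apply: linear_lfun => a x z; rewrite linearP /= opprD addrACA -scalerBr linearP.
exists u; rewrite uE; split=> // x xU.
by rewrite uE projv_id // subrr linear0.
Qed.

End Linear.

(** * Local endomorphism rings and direct summands *)

Section Reps.

Variable K : fieldType.
Implicit Types M A B : rep K.

Definition rhom M M' (g1 : 'Hom(rsp1 M, rsp1 M')) (g2 : 'Hom(rsp2 M, rsp2 M')) :=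
  (forall x, g2 (rarr M x) = rarr M' (g1 x)) /\
  (forall x, g2 (rloop M x) = rloop M' (g2 x)).

(** Locality of the endomorphism ring when its residue field is K: scalars and
    nilpotents exhaust it.  The scalar is common to both vertices. *)
Definition rlocal M := forall e1 e2, @rhom M M e1 e2 ->
  exists c, sole_eigenvalue e1 c /\ sole_eigenvalue e2 c.

Lemma rhom_comp M M' M'' g1 g2 h1 h2 :
  @rhom M M' g1 g2 -> @rhom M' M'' h1 h2 -> rhom (h1 \o g1)%VF (h2 \o g2)%VF.
Proof.
move=> [gf gl] [hf hl]; split=> x; rewrite !comp_lfunE.
  by rewrite gf hf.
by rewrite gl hl.
Qed.

Lemma rhom_cancel M M' g1 g2 (h1 : 'Hom(rsp1 M', rsp1 M))
    (h2 : 'Hom(rsp2 M', rsp2 M)) : @rhom M M' g1 g2 ->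
  cancel g1 h1 -> cancel h1 g1 -> cancel g2 h2 -> cancel h2 g2 -> @rhom M' M h1 h2.
Proof.
move=> [gf gl] K1 K1' K2 K2'; split=> x; apply: (can_inj K2).
  by rewrite gf K1' K2'.
by rewrite gl !K2'.
Qed.

Lemma risoP M M' : riso M M' <-> exists g1 g2 h1 h2,
  [/\ @rhom M M' g1 g2, @rhom M' M h1 h2, cancel g1 h1 /\ cancel h1 g1
    & cancel g2 h2 /\ cancel h2 g2].
Proof.
split=> [[g1 [g2 [b1 b2 gf gl]]]|[g1 [g2 [h1 [h2 [[gf gl] _ [K1 K1'] [K2 K2']]]]]]].
  have [K1 K1'] := bij_lfun_inverse b1; have [K2 K2'] := bij_lfun_inverse b2.
  exists g1, g2, (g1^-1)%VF, (g2^-1)%VF; split=> //.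
  by apply: rhom_cancel K1 K1' K2 K2'; split.
by exists g1, g2; split=> //; [exists h1|exists h2].
Qed.

Lemma rzeroP M : rzero M <-> (forall x : rsp1 M, x = 0) /\ (forall x : rsp2 M, x = 0).
Proof. by rewrite /rzero !dim_eq0P. Qed.

(** The projection onto the summand A is idempotent, so it is 1 or 0 according
    to whether its only eigenvalue is 1. *)
Lemma local_indec M : ~ rzero M -> rlocal M -> rindec M.
Proof.
move=> M0 Mloc; split=> // A B /risoP[g1 [g2 [h1 [h2 [[gf gl] [hf hl] [K1 K1'] [K2 K2']]]]]].
have [p1 p1E] : exists p : 'End(rsp1 M), p =1 (fun x => h1 ((g1 x).1, 0)).
  by apply: linear_lfun => a x y; rewrite [g1 _]linearP -[RHS]linearP; congr (h1 _);
    apply: injective_projections => /=; rewrite ?scaler0 ?addr0.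
have [p2 p2E] : exists p : 'End(rsp2 M), p =1 (fun x => h2 ((g2 x).1, 0)).
  by apply: linear_lfun => a x y; rewrite [g2 _]linearP -[RHS]linearP; congr (h2 _);
    apply: injective_projections => /=; rewrite ?scaler0 ?addr0.
have pM : rhom p1 p2.
  split=> x; rewrite ?p1E !p2E.
    by rewrite gf -hf; congr (h2 _); rewrite /= !hom_pairE /= linear0.
  by rewrite gl -hl; congr (h2 _); rewrite /= !hom_pairE /= linear0.
have [c [e1 e2]] := Mloc _ _ pM.
have i1 x : p1 (p1 x) = p1 x by rewrite !p1E K1'.
have i2 x : p2 (p2 x) = p2 x by rewrite !p2E K2'.
have [c1|c1] := eqVneq c 1; [right|left]; apply/rzeroP.
  have c0 : c != 0 by rewrite c1 oner_neq0.
  split=> b.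
    have := sole_eigenvalue_idem1 e1 i1 c0 (h1 (0, b)); rewrite p1E K1' /=.
    by move/(can_inj K1') => [].
  have := sole_eigenvalue_idem1 e2 i2 c0 (h2 (0, b)); rewrite p2E K2' /=.
  by move/(can_inj K2') => [].
split=> b.
  have := sole_eigenvalue_idem0 e1 i1 c1 (h1 (b, 0)); rewrite p1E K1' /=.
  by rewrite -[RHS](linear0 h1) => /(can_inj K1') [].
have := sole_eigenvalue_idem0 e2 i2 c1 (h2 (b, 0)); rewrite p2E K2' /=.
by rewrite -[RHS](linear0 h2) => /(can_inj K2') [].
Qed.

(** A representation also if the subspaces are not stable: the maps are then
    followed by projections. *)
Definition subrep M (W1 : {vspace rsp1 M}) (W2 : {vspace rsp2 M}) : rep K :=
  @Rep K (subvs_of W1) (subvs_of W2)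
    (linfun (vsproj W2) \o rarr M \o linfun (@vsval _ _ W1))%VF
    (linfun (vsproj W2) \o rloop M \o linfun (@vsval _ _ W2))%VF.

(** An idempotent endomorphism splits M into its image and its kernel. *)
Lemma indec_idempotent M p1 p2 : rindec M -> @rhom M M p1 p2 ->
    (forall x, p1 (p1 x) = p1 x) -> (forall x, p2 (p2 x) = p2 x) ->
  ((forall x, p1 x = 0) /\ (forall x, p2 x = 0)) \/
  ((forall x, p1 x = x) /\ (forall x, p2 x = x)).
Proof.
move=> [_ Mind] [pf pl] i1 i2.
pose q1 := (\1 - p1)%VF; pose q2 := (\1 - p2)%VF.
have q1E x : q1 x = x - p1 x by rewrite lfunE /= !lfunE.
have q2E x : q2 x = x - p2 x by rewrite lfunE /= !lfunE.
clearbody q1 q2.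
pose A := subrep (limg p1) (limg p2); pose B := subrep (limg q1) (limg q2).
have mp1 x : p1 x \in limg p1 by rewrite memv_img ?memvf.
have mp2 x : p2 x \in limg p2 by rewrite memv_img ?memvf.
have mq1 x : q1 x \in limg q1 by rewrite memv_img ?memvf.
have mq2 x : q2 x \in limg q2 by rewrite memv_img ?memvf.
have lp1 x : x \in limg p1 -> p1 x = x by move=> /memv_imgP[y _ ->].
have lp2 x : x \in limg p2 -> p2 x = x by move=> /memv_imgP[y _ ->].
have lq1 x : x \in limg q1 -> p1 x = 0.
  by move=> /memv_imgP[y _ ->]; rewrite q1E linearB /= i1 subrr.
have lq2 x : x \in limg q2 -> p2 x = 0.
  by move=> /memv_imgP[y _ ->]; rewrite q2E linearB /= i2 subrr.
have [g1 g1E] : exists g : 'Hom(rsp1 M, rsp1 (rsum A B)),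
    g =1 (fun x => (vsproj (limg p1) (p1 x), vsproj (limg q1) (q1 x))).
  by apply: linear_lfun => a x y; rewrite !linearP.
have [g2 g2E] : exists g : 'Hom(rsp2 M, rsp2 (rsum A B)),
    g =1 (fun x => (vsproj (limg p2) (p2 x), vsproj (limg q2) (q2 x))).
  by apply: linear_lfun => a x y; rewrite !linearP.
have bij1 : bijective g1.
  exists (fun u => vsval u.1 + vsval u.2) => [x|[a b]]; rewrite g1E /=.
    by rewrite !vsprojK // q1E addrC subrK.
  have pa : p1 (vsval a + vsval b) = vsval a.
    by rewrite linearD /= lp1 ?subvsP // lq1 ?subvsP // addr0.
  by rewrite q1E pa [vsval a + _]addrC addrK !vsvalK.
have bij2 : bijective g2.
  exists (fun u => vsval u.1 + vsval u.2) => [x|[a b]]; rewrite g2E /=.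
    by rewrite !vsprojK // q2E addrC subrK.
  have pa : p2 (vsval a + vsval b) = vsval a.
    by rewrite linearD /= lp2 ?subvsP // lq2 ?subvsP // addr0.
  by rewrite q2E pa [vsval a + _]addrC addrK !vsvalK.
have qf x : q2 (rarr M x) = rarr M (q1 x) by rewrite q1E q2E pf linearB.
have ql x : q2 (rloop M x) = rloop M (q2 x) by rewrite !q2E pl linearB.
have iso : riso M (rsum A B).
  exists g1, g2; split=> // x; rewrite ?g1E !g2E /rsum /= hom_pairE /=.
    by rewrite !comp_lfunE !lfunE /= !vsprojK // pf qf.
  by rewrite !comp_lfunE !lfunE /= !vsprojK // pl ql.
have [/rzeroP[A1 A2]|/rzeroP[B1 B2]] := Mind _ _ iso; [left|right]; split=> x.
- by rewrite -(vsprojK (mp1 x)) (A1 (vsproj _ _)) linear0.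
- by rewrite -(vsprojK (mp2 x)) (A2 (vsproj _ _)) linear0.
- by apply/esym/eqP; rewrite -subr_eq0 -q1E -(vsprojK (mq1 x)) (B1 (vsproj _ _)) linear0.
- by apply/esym/eqP; rewrite -subr_eq0 -q2E -(vsprojK (mq2 x)) (B2 (vsproj _ _)) linear0.
Qed.

(** Since h g is invertible, g (h g)^-1 h is an idempotent of M with image
    isomorphic to X; it is not 0, so it is 1. *)
Lemma indec_summand_iso M X g1 g2 h1 h2 c : rindec M -> ~ rzero X ->
    @rhom X M g1 g2 -> @rhom M X h1 h2 ->
    sole_eigenvalue (h1 \o g1)%VF c -> sole_eigenvalue (h2 \o g2)%VF c -> c != 0 ->
  riso M X.
Proof.
move=> Mi X0 gM hM u1 u2 c0.
set e1 := (h1 \o g1)%VF in u1; set e2 := (h2 \o g2)%VF in u2.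
have [K1 K1'] := inj_end_inverse (fun x => sole_eigenvalue_inj u1 c0).
have [K2 K2'] := inj_end_inverse (fun x => sole_eigenvalue_inj u2 c0).
have iM := rhom_cancel (rhom_comp gM hM) K1 K1' K2 K2'.
have kM := rhom_comp hM iM; set k1 := (_ \o h1)%VF in kM; set k2 := (_ \o h2)%VF in kM.
have kg1 : cancel g1 k1 by move=> x; rewrite comp_lfunE -[RHS]K1 comp_lfunE.
have kg2 : cancel g2 k2 by move=> x; rewrite comp_lfunE -[RHS]K2 comp_lfunE.
clearbody k1 k2.
have := indec_idempotent Mi (rhom_comp kM gM); case.
- by move=> x; rewrite !comp_lfunE kg1.
- by move=> x; rewrite !comp_lfunE kg2.
- move=> [z1 z2]; case: X0; apply/rzeroP; split=> x.
    by rewrite -(kg1 x) -{1}(kg1 x) -[g1 (k1 _)]comp_lfunE z1 linear0.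
  by rewrite -(kg2 x) -{1}(kg2 x) -[g2 (k2 _)]comp_lfunE z2 linear0.
- move=> [z1 z2]; apply/risoP; exists k1, k2, g1, g2; split=> //.
    by split=> // x; rewrite -[LHS]comp_lfunE z1.
  by split=> // x; rewrite -[LHS]comp_lfunE z2.
Qed.

End Reps.

(** * Explicit graded representations *)

(** The representation K^i -> K^j given by the natural embedding, with [i] =
    [msrc], [j] = [mtgt] and loop the matrix with entry [x] at (a, b) for every
    ((a, b), x) in [mloop] (rows and columns numbered from 0).  The standard
    basis is homogeneous for a grading by the rows of the covering quiver: the
    a-th basis vector of K^j, and the a-th one of K^i, has degree [mdeg]`_a;
    the arrow preserves degrees and the loop raises them by one. *)
Record model := Model {
  msrc : nat;
  mtgt : nat;
  mdeg : seq nat;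
  mloop : zform nat2
}.

Definition mdim (u : model) := maxn (msrc u) (mtgt u).
Definition mdegree (u : model) (a : nat) : nat := nth 0%N (mdeg u) a.
Definition mcol (u : model) (b : nat) : zform nat :=
  [seq (p.1.1, p.2) | p <- mloop u & p.1.2 == b].
Definition mrow (u : model) (a : nat) : zform nat :=
  [seq (p.1.2, p.2) | p <- mloop u & p.1.1 == a].

Definition model_ok (u : model) : bool :=
  [&& (msrc u <= mtgt u)%N || (mtgt u == 0%N),
      (0 < mdim u)%N, size (mdeg u) == mdim u,
      all (fun p => [&& p.1.1 < mtgt u, p.1.2 < mtgt u
                      & mdegree u p.1.1 == (mdegree u p.1.2).+1]%N) (mloop u)
    & all (fun a => nilp (fsubst (mrow u) (fsubst (mrow u) (mrow u a))))
          (iota 0 (mtgt u))].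

Definition pairs (n : nat) : seq nat2 :=
  [seq (a, b) | a <- iota 0 n, b <- iota 0 n].

(** The symbol (a, b) stands for the entry of an endomorphism e of K^j; the
    form is the (a, b) entry of e N - N e, with N the matrix of the loop. *)
Definition comm_form (u : model) (a b : nat) : zform nat2 :=
  [seq ((a, p.1), p.2) | p <- mcol u b] ++
  [seq ((p.1, b), (- p.2)%R) | p <- mrow u a].

(** Besides commuting with the loop, the second component of an endomorphism of
    the representation preserves the image of K^i. *)
Definition end_hyps (u : model) : seq (zform nat2) :=
  [seq comm_form u p.1 p.2 | p <- pairs (mtgt u)] ++
  [seq [:: (p, 1%R)] | p <- pairs (mtgt u) & (p.2 < msrc u <= p.1)%N].

Definition tri_goals (u : model) : seq (zform nat2) :=
  [seq if p.1 == p.2 then [:: (p, 1%R); ((0%N, 0%N), (-1)%R)] else [:: (p, 1%R)]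
  | p <- pairs (mdim u) & (mdegree u p.1 <= mdegree u p.2)%N].

(** * Explicit almost split maps *)

(** One component of a left almost split map U -> E.  It consists of the number
    of a representation X in the list, of the images in X of the basis vectors
    of the second space of U, and of the images in E of those of X; see
    [almost_split] for the symbols that occur in the latter.  Components to
    K -> 0 are left out, being zero at the second vertex.  A tuple rather
    than a record, so that arrows inherit a decidable equality. *)
Definition arrow : eqType := (nat * seq (zform nat) * seq (zform nat2))%type.
Definition Arrow k S L : arrow := (k, S, L).
Definition arrow_to (x : arrow) : nat := x.1.1.
Definition arrow_proj (x : arrow) a : zform nat := nth [::] x.1.2 a.
Definition arrow_incls (x : arrow) : seq (zform nat2) := x.2.
Definition arrow_incl (x : arrow) b : zform nat2 := nth [::] (arrow_incls x) b.

(** The almost split sequence that starts in U, written out.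

    Let q = [as_width] be the dimension of the kernel of the loop on U.  Choose
    q functionals w_0, ..., w_(q-1) on the second space of U that restrict to a
    basis of the dual of this kernel.  The map u |-> (w_r (loop^d u)), for r < q
    and d < 3, embeds U in q copies of the injective hull of the simple
    representation at the second vertex.  The symbol (d, r) stands for the
    functional w_r o loop^d.  In these symbols, [as_coord] lists the coordinate
    functions of U and [as_rel] generates, together with composition with the
    loop, the relations between the functionals on U.  So [as_rel] and the
    coordinates that vanish on the first space of U are the equations that cut
    U out of its injective hull.

    The same equations, read as a linear system for unknowns z_s in a
    representation M, decide which maps from U to M extend along U -> E: it is
    solvable when its right-hand side is the image of the socle vector
    [as_elt], placed in component 0.  The universal solution is the push-out E
    of U; in E, the symbol (0, a) stands for the a-th basis vector of U and
    (s + 1, d) for loop^d z_s.  Finally [as_fun] expresses w_0 in the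
    coordinates of U, and [as_height] is the length of the longest chain of
    nonzero matrix entries of successive arrows that leaves a basis vector. *)
Record almost_split := AlmostSplit {
  as_width : nat;
  as_elt : zform nat;
  as_fun : zform nat;
  as_coord : seq (zform nat2);
  as_rel : seq (zform nat2);
  as_height : seq nat;
  as_arrows : seq arrow
}.

(** The value of [as_fun] at e ([as_elt]) minus the first diagonal entry of e, in
    the entries (a, b) of e.  It vanishes for every endomorphism e of U, so that
    the scalar part of e can be read off from one functional. *)
Definition trace_form (s : almost_split) : zform nat2 :=
  ((0%N, 0%N), (-1)%R) ::
  [seq ((p.1, r.1), (p.2 * r.2)%R) | p <- as_fun s, r <- as_elt s].

Definition brick_ok (u : model) (s : almost_split) : bool :=
  fentails (end_hyps u)
    (if mtgt u == 0%N then tri_goals u else trace_form s :: tri_goals u).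

(** Composition of functionals with the loop, whose cube is zero. *)
Definition fshift (f : zform nat2) : zform nat2 :=
  [seq ((p.1.1.+1, p.1.2), p.2) | p <- f & (p.1.1 < 2)%N].

Definition rel_forms (s : almost_split) :=
  as_rel s ++ map fshift (as_rel s) ++ map (fshift \o fshift) (as_rel s).

Definition acoord s a := nth [::] (as_coord s) a.

Definition loop_goal (u : model) (s : almost_split) (a : nat) : zform nat2 :=
  fmuladd (-1) (fshift (acoord s a)) (fsubst (acoord s) (mrow u a)).

(** On any M, functionals w_r that satisfy [as_rel] define by [as_coord] a map
    to K^j that commutes with the loops, and w_0 factors through it. *)
Definition dual_ok (u : model) (s : almost_split) : bool :=
  fentails (rel_forms s)
    (fmuladd (-1) (fsubst (acoord s) (as_fun s)) [:: ((0%N, 0%N), 1%R)] ::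
     map (loop_goal u s) (iota 0 (mtgt u))).

(** The coordinates beyond the i-th come first: they need only vanish on the
    image of the arrow, and dually their unknowns z_s are taken in that image. *)
Definition tests (u : model) s := drop (msrc u) (as_coord s) ++ as_rel s.

Definition test_comp (f : zform nat2) (r : nat) : zform nat :=
  [seq (p.1.1, p.2) | p <- f & p.1.2 == r].

Definition push_rel (u : model) s (r : nat) : zform nat2 :=
  (if r == 0%N then [seq ((0%N, p.1), (- p.2)%R) | p <- as_elt s] else [::]) ++
  flatten [seq [seq ((z.+1, p.1), p.2) | p <- test_comp (nth [::] (tests u s) z) r]
          | z <- iota 0 (size (tests u s))].

Definition push_loop (u : model) (k : nat * nat) : zform nat2 :=
  if k.1 == 0%N then [seq ((0%N, p.1), p.2) | p <- mcol u k.2]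
  else if (k.2 < 2)%N then [:: ((k.1, k.2.+1), 1%R)] else [::].

Definition push_rels (u : model) s : seq (zform nat2) :=
  let h := [seq push_rel u s r | r <- iota 0 (as_width s)] in
  let h' := map (fsubst (push_loop u)) h in
  h ++ h' ++ map (fsubst (push_loop u)) h'.

(** Generators of the first space of E. *)
Definition push_src (u : model) (s : almost_split) : seq (zform nat2) :=
  [seq [:: ((0%N, a), 1%R)] | a <- iota 0 (msrc u)] ++
  [seq [:: ((z.+1, 0%N), 1%R)] | z <- iota 0 (size (as_coord s) - msrc u)].

Section Tables.

Variables (ms : seq model) (ss : seq almost_split).

Definition model0 := Model 0 0 [::] [::].
Definition split0 := AlmostSplit 0 [::] [::] [::] [::] [::] [::].

Definition nmodel k := nth model0 ms k.
Definition nsplit k := nth split0 ss k.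

Definition arrow_ok u s (x : arrow) : bool :=
  (size (arrow_incls x) == mtgt (nmodel (arrow_to x))) &&
  fentails (push_rels u s ++ push_src u s)
           (take (msrc (nmodel (arrow_to x))) (arrow_incls x)).

Definition hom_goal u (x : arrow) (b : nat) : zform nat2 :=
  fmuladd (-1) (fsubst (push_loop u) (arrow_incl x b))
          (fsubst (arrow_incl x) (mcol (nmodel (arrow_to x)) b)).

Definition sum_goal (s : almost_split) (a : nat) : zform nat2 :=
  foldr (fun x h => fmuladd 1 (fsubst (arrow_incl x) (arrow_proj x a)) h)
        [:: ((0%N, a), (-1)%R)] (as_arrows s).

(** In E, the arrows define maps of representations X -> E, and at the second
    vertex U -> E is the sum of the composites U -> X -> E. *)
Definition factor_ok u s : bool :=
  fentails (push_rels u s)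
    (map (sum_goal s) (iota 0 (mtgt u)) ++
     [seq hom_goal u x b | x <- as_arrows s, b <- iota 0 (mtgt (nmodel (arrow_to x)))]) &&
  all (arrow_ok u s) (as_arrows s).

Definition height k a := nth 0%N (as_height (nsplit k)) a.

(** This reflects that the Auslander-Reiten quiver of the covering has no
    oriented cycle, and makes the induction of [all_hom0] possible. *)
Definition height_ok k : bool :=
  all (fun x => (arrow_to x < size ms)%N &&
    all (fun a => all (fun p => (p.1 < mtgt (nmodel (arrow_to x)))%N &&
                            (height (arrow_to x) p.1 < height k a)%N) (arrow_proj x a))
        (iota 0 (mtgt (nmodel k))))
    (as_arrows (nsplit k)).

Definition split_ok k : bool :=
  let u := nmodel k in let s := nsplit k in
  [&& (size (as_coord s) == mtgt u),
      all (fun p => p.1 < mtgt u)%N (as_elt s),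
      dual_ok u s, factor_ok u s & height_ok k].

(** The representation K -> 0 has no vector at the second vertex, and no almost
    split map is required for it. *)
Definition all_ok : bool :=
  all (fun k => [&& model_ok (nmodel k), brick_ok (nmodel k) (nsplit k)
                  & (mtgt (nmodel k) == 0)%N || split_ok k])
      (iota 0 (size ms)).

End Tables.

(** * The thirty representations and their almost split maps *)

Definition pos (T : Type) (k : T) : T * int := (k, 1).
Definition neg (T : Type) (k : T) : T * int := (k, -1).

Section Data.

Local Open Scope nat_scope.

(** The order is that of [Ulist]. *)
Definition models : seq model := [::
  Model 0 1 [:: 0] [::];
  Model 1 1 [:: 0] [::];
  Model 1 0 [:: 0] [::];
  Model 0 2 [:: 0;1] [:: pos (1,0)];
  Model 1 2 [:: 0;1] [:: pos (1,0)];
  Model 1 2 [:: 1;0] [:: pos (0,1)];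
  Model 2 2 [:: 0;1] [:: pos (1,0)];
  Model 0 3 [:: 0;1;2] [:: pos (1,0); pos (2,1)];
  Model 1 3 [:: 0;1;2] [:: pos (1,0); pos (2,1)];
  Model 2 3 [:: 0;1;2] [:: pos (1,0); pos (2,1)];
  Model 1 3 [:: 1;0;2] [:: pos (2,0); pos (0,1)];
  Model 2 3 [:: 0;2;1] [:: pos (2,0); pos (1,2)];
  Model 3 3 [:: 0;1;2] [:: pos (1,0); pos (2,1)];
  Model 1 3 [:: 2;1;0] [:: pos (0,1); pos (1,2)];
  Model 2 3 [:: 2;1;0] [:: pos (0,1); pos (1,2)];
  Model 1 4 [:: 1;2;1;0] [:: pos (1,0); pos (1,2); pos (2,3)];
  Model 2 4 [:: 0;1;1;2] [:: pos (2,0); pos (3,1); pos (3,2)];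
  Model 2 4 [:: 2;1;1;0] [:: pos (0,1); pos (0,2); pos (2,3)];
  Model 3 4 [:: 2;1;0;1] [:: pos (0,1); pos (0,3); pos (3,2)];
  Model 2 5 [:: 1;0;2;1;0] [:: pos (2,0); pos (3,1); pos (2,3); pos (0,4)];
  Model 2 5 [:: 2;1;2;1;0] [:: pos (2,1); pos (0,3); pos (1,4); pos (3,4)];
  Model 3 5 [:: 2;1;0;2;1] [:: pos (3,1); pos (1,2); pos (4,2); pos (0,4)];
  Model 3 5 [:: 2;1;0;1;0] [:: pos (0,1); pos (3,2); pos (0,3); pos (1,4)];
  Model 2 6 [:: 1;2;0;1;2;3] [:: pos (0,2); pos (1,0); pos (1,3); neg (3,2); pos (4,0); pos (5,1)];
  Model 3 6 [:: 2;1;0;2;1;0] [:: pos (0,1); pos (3,1); pos (4,2); pos (3,4); pos (1,5); neg (4,5)];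
  Model 3 6 [:: 0;1;2;1;2;3] [:: pos (1,0); pos (2,1); pos (2,3); neg (3,0); pos (4,1); pos (5,2)];
  Model 3 6 [:: 1;2;3;0;1;2] [:: pos (1,4); pos (2,1); pos (2,5); pos (4,3); pos (5,0); neg (5,4)];
  Model 4 6 [:: 0;1;2;3;1;2] [:: pos (1,0); pos (2,1); pos (2,4); pos (3,2); neg (4,0); pos (5,1)];
  Model 3 7 [:: 2;1;0;2;1;1;0] [:: pos (0,1); pos (3,1); neg (5,2); neg (0,4); neg (3,5); neg (4,6)];
  Model 4 7 [:: 2;1;1;0;2;1;0] [:: pos (4,1); pos (0,2); pos (1,3); pos (5,3); pos (2,6); pos (5,6)]].

(** The entry of K -> 0, the third one, is a dummy. *)
Definition almost_splits : seq almost_split := [::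
  AlmostSplit 1 [:: pos 0] [:: pos 0]
    [:: [:: pos (0,0)]]
    [:: [:: pos (1,0)]]
    [:: 17]
    [:: Arrow 15
          [:: [:: neg 0; pos 2]]
          [:: [:: neg (1,0)]; [:: pos (2,2)]; [:: pos (2,1)]; [:: pos (2,0)]]];
  AlmostSplit 1 [:: pos 0] [:: pos 0]
    [:: [:: pos (0,0)]]
    [:: [:: pos (1,0)]]
    [:: 11]
    [:: Arrow 5
          [:: [:: pos 0]]
          [:: [:: pos (1,1)]; [:: pos (1,0)]]];
  AlmostSplit 0 [::] [::] [::] [::] [::] [::];
  AlmostSplit 1 [:: pos 1] [:: pos 1]
    [:: [:: pos (1,0)]; [:: pos (0,0)]]
    [:: [:: pos (2,0)]]
    [:: 21;13]
    [:: Arrow 7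
          [:: [:: pos 1]; [:: pos 2]]
          [:: [:: pos (3,0)]; [:: pos (3,1)]; [:: pos (3,2)]];
        Arrow 19
          [:: [:: pos 1; neg 4]; [:: neg 0; pos 3]]
          [:: [:: neg (2,0)]; [:: pos (1,0)]; [:: neg (2,1)]; [:: pos (1,1)];
              [:: neg (0,0); pos (1,0); pos (3,1)]]];
  AlmostSplit 1 [:: pos 1] [:: pos 1]
    [:: [:: pos (1,0)]; [:: pos (0,0)]]
    [:: [:: pos (2,0)]]
    [:: 18;10]
    [:: Arrow 20
          [:: [:: pos 1]; [:: pos 2]]
          [:: [:: neg (1,0)]; [:: pos (0,0)]; [:: pos (1,0); pos (2,2)];
              [:: neg (0,0); pos (2,1)]; [:: pos (2,0)]]];
  AlmostSplit 1 [:: pos 0] [:: pos 0]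
    [:: [:: pos (0,0)]; [:: pos (1,0)]]
    [:: [:: pos (2,0)]]
    [:: 10;18]
    [:: Arrow 0
          [:: [::]; [:: neg 0]]
          [:: [:: neg (0,1); pos (1,0); pos (2,1)]];
        Arrow 20
          [:: [:: pos 0]; [:: pos 3]]
          [:: [:: pos (1,1); pos (2,2)]; [:: neg (1,0)]; [:: neg (1,1)];
              [:: pos (1,0); pos (2,1)]; [:: pos (2,0)]]];
  AlmostSplit 1 [:: pos 1] [:: pos 1]
    [:: [:: pos (1,0)]; [:: pos (0,0)]]
    [:: [:: pos (2,0)]]
    [:: 15;7]
    [:: Arrow 17
          [:: [:: pos 1]; [:: pos 0]]
          [:: [:: pos (1,2)]; [:: pos (0,0)]; [:: pos (1,1)]; [:: pos (1,0)]]];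
  AlmostSplit 1 [:: pos 2] [:: pos 2]
    [:: [:: pos (2,0)]; [:: pos (1,0)]; [:: pos (0,0)]]
    [::]
    [:: 28;20;12]
    [:: Arrow 8
          [:: [:: pos 0]; [:: pos 1]; [:: pos 2]]
          [:: [:: pos (1,0)]; [:: pos (1,1)]; [:: pos (1,2)]];
        Arrow 23
          [:: [:: neg 2]; [:: neg 0; pos 3]; [:: neg 4]]
          [:: [:: neg (2,0)]; [:: pos (3,0)]; [:: neg (0,0); pos (1,0)];
              [:: pos (0,1); neg (1,1); neg (2,0)]; [:: neg (2,1); neg (3,0)];
              [:: pos (3,1)]]];
  AlmostSplit 1 [:: pos 2] [:: pos 2]
    [:: [:: pos (2,0)]; [:: pos (1,0)]; [:: pos (0,0)]]
    [::]
    [:: 27;19;11]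
    [:: Arrow 25
          [:: [:: neg 0]; [:: neg 1; pos 3]; [:: neg 4]]
          [:: [:: neg (0,0)]; [:: neg (1,0)]; [:: pos (2,0)];
              [:: pos (0,1); neg (1,0)]; [:: neg (1,1); neg (2,0)]; [:: pos (2,1)]]];
  AlmostSplit 1 [:: pos 2] [:: pos 2]
    [:: [:: pos (2,0)]; [:: pos (1,0)]; [:: pos (0,0)]]
    [::]
    [:: 17;9;1]
    [:: Arrow 12
          [:: [:: pos 0]; [:: pos 1]; [:: pos 2]]
          [:: [:: pos (0,0)]; [:: pos (0,1)]; [:: pos (1,0)]]];
  AlmostSplit 1 [:: pos 2] [:: pos 2]
    [:: [:: pos (1,0)]; [:: pos (2,0)]; [:: pos (0,0)]]
    [::]
    [:: 15;23;7]
    [:: Arrow 24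
          [:: [:: neg 1]; [:: neg 2; neg 5]; [:: neg 0; neg 3]]
          [:: [:: neg (2,0)]; [:: neg (0,0)]; [:: neg (1,0)]; [:: neg (1,2)];
              [:: neg (1,1)]; [:: neg (0,1); pos (1,0)]]];
  AlmostSplit 1 [:: pos 1] [:: pos 1]
    [:: [:: pos (2,0)]; [:: pos (0,0)]; [:: pos (1,0)]]
    [::]
    [:: 21;5;13]
    [:: Arrow 18
          [:: [:: pos 2]; [:: pos 0]; [:: pos 3]]
          [:: [:: pos (1,1)]; [:: pos (1,0)]; [:: pos (0,0)]; [:: pos (0,2)]]];
  AlmostSplit 1 [:: pos 2] [:: pos 2]
    [:: [:: pos (2,0)]; [:: pos (1,0)]; [:: pos (0,0)]]
    [::]
    [:: 16;8;0]
    [:: Arrow 6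
          [:: [:: pos 0]; [:: pos 1]; [::]]
          [:: [:: pos (0,0)]; [:: pos (0,1)]]];
  AlmostSplit 1 [:: pos 0] [:: pos 0]
    [:: [:: pos (0,0)]; [:: pos (1,0)]; [:: pos (2,0)]]
    [::]
    [:: 8;16;24]
    [:: Arrow 28
          [:: [:: pos 0]; [:: neg 4]; [:: pos 6]]
          [:: [:: pos (1,1); pos (2,2)]; [:: pos (1,0)]; [:: neg (2,0)];
              [:: neg (2,2)]; [:: neg (0,1)]; [:: pos (2,1)]; [:: pos (0,2)]]];
  AlmostSplit 1 [:: pos 0] [:: pos 0]
    [:: [:: pos (0,0)]; [:: pos (1,0)]; [:: pos (2,0)]]
    [::]
    [:: 4;12;20]
    [:: Arrow 22
          [:: [:: pos 0]; [:: pos 1]; [:: pos 4]]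
          [:: [:: pos (1,2)]; [:: pos (0,1)]; [:: pos (1,0)]; [:: pos (1,1)];
              [:: pos (0,2)]]];
  AlmostSplit 2 [:: pos 0; neg 2] [:: pos 0]
    [:: [:: pos (0,0)]; [:: pos (0,1)]; [:: neg (0,0); pos (1,1)]; [:: pos (2,1)]]
    [:: [:: pos (1,0)]]
    [:: 16;8;16;24]
    [:: Arrow 10
          [:: [:: pos 0]; [:: pos 2]; [:: pos 0]; [:: pos 1]]
          [:: [:: pos (0,2); pos (4,1)]; [:: pos (0,3); pos (4,0)];
              [:: pos (0,1); pos (4,2)]];
        Arrow 28
          [:: [:: neg 1]; [:: neg 0; neg 3]; [:: pos 4; pos 5]; [:: neg 2; neg 6]]
          [:: [:: pos (3,2); pos (4,2)]; [:: pos (2,0)]; [:: neg (3,0)];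
              [:: neg (3,2)]; [:: neg (3,1); neg (4,1)]; [:: pos (3,1)];
              [:: pos (3,0); pos (4,0)]]];
  AlmostSplit 2 [:: pos 1; neg 2] [:: pos 1]
    [:: [:: pos (2,1)]; [:: pos (0,0)]; [:: neg (0,0); pos (1,1)]; [:: pos (0,1)]]
    [:: [:: pos (1,0)]]
    [:: 22;14;14;6]
    [:: Arrow 29
          [:: [:: neg 3]; [:: neg 1]; [:: neg 1; neg 5]; [:: neg 4]]
          [:: [:: pos (3,2)]; [:: neg (0,2); pos (1,0); neg (3,1)]; [:: pos (1,0)];
              [:: neg (0,0)]; [:: neg (0,3)]; [:: neg (1,0); pos (3,1)];
              [:: pos (3,0)]]];
  AlmostSplit 2 [:: pos 1; neg 2] [:: pos 1]
    [:: [:: pos (0,1)]; [:: pos (0,0)]; [:: neg (0,0); pos (1,1)]; [:: pos (2,1)]]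
    [:: [:: pos (1,0)]]
    [:: 6;14;14;22]
    [:: Arrow 3
          [:: [::]; [::]; [:: neg 1]; [:: neg 0]]
          [:: [:: pos (2,0); pos (3,0)]; [:: pos (2,1); pos (3,1)]];
        Arrow 29
          [:: [:: pos 0]; [:: pos 2]; [:: pos 2; pos 5]; [:: pos 6]]
          [:: [:: pos (0,0)]; [:: neg (1,0)]; [:: pos (0,2); neg (1,0); pos (3,1)];
              [:: pos (2,0)]; [:: neg (3,2)]; [:: pos (1,0); pos (2,1)];
              [:: pos (0,3); pos (2,0); pos (3,0)]]];
  AlmostSplit 2 [:: pos 1; neg 3] [:: pos 1]
    [:: [:: pos (0,1)]; [:: pos (0,0)]; [:: pos (2,1)]; [:: neg (0,0); pos (1,1)]]
    [:: [:: pos (1,0)]]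
    [:: 4;12;20;12]
    [:: Arrow 1
          [:: [::]; [:: neg 0]; [::]; [::]]
          [:: [:: pos (1,0)]];
        Arrow 22
          [:: [:: pos 0]; [:: pos 1]; [:: pos 2]; [:: pos 3]]
          [:: [:: pos (0,0)]; [:: pos (0,3); pos (2,1)]; [:: pos (0,2)];
              [:: pos (0,3)]; [:: pos (0,2); pos (2,0)]]];
  AlmostSplit 2 [:: pos 0; neg 3] [:: pos 0]
    [:: [:: pos (0,0)]; [:: neg (1,0); pos (2,1)]; [:: pos (0,1)];
        [:: neg (0,0); pos (1,1)]; [:: pos (1,0)]]
    [:: [:: pos (2,0)]]
    [:: 12;20;4;12;20]
    [:: Arrow 22
          [:: [:: neg 1]; [:: neg 2]; [:: neg 0]; [:: neg 3]; [:: neg 4]]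
          [:: [:: pos (3,2)]; [:: pos (2,0)]; [:: pos (3,0)]; [:: pos (3,1)];
              [:: pos (0,1); neg (0,4); pos (3,0); pos (4,1)]];
        Arrow 23
          [:: [:: pos 1]; [:: pos 0]; [:: pos 5]; [:: pos 1; pos 4]; [:: pos 3]]
          [:: [:: pos (0,1); pos (3,0)]; [:: pos (0,3); pos (3,1); pos (4,2)];
              [:: neg (4,0)]; [:: pos (0,1); pos (3,0); pos (4,1)]; [:: neg (4,2)];
              [:: pos (0,2); pos (3,2)]]];
  AlmostSplit 2 [:: pos 0] [:: pos 0]
    [:: [:: pos (0,0)]; [:: pos (1,1)]; [:: pos (0,1)]; [:: pos (1,0)];
        [:: pos (2,0)]]
    [:: [:: neg (2,0); pos (2,1)]]
    [:: 9;17;9;17;25]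
    [:: Arrow 13
          [:: [:: neg 0]; [::]; [::]; [:: neg 1]; [:: neg 2]]
          [:: [:: pos (4,2)]; [:: pos (4,1)]; [:: pos (4,0)]];
        Arrow 15
          [:: [::]; [:: pos 0]; [:: pos 1]; [:: neg 0; pos 2]; [:: pos 3]]
          [:: [:: pos (0,1); pos (2,0)]; [:: pos (0,2); pos (2,1)];
              [:: pos (0,1); pos (0,3); neg (3,1); pos (4,1)];
              [:: pos (0,4); neg (3,0); pos (4,0)]];
        Arrow 21
          [:: [:: pos 0]; [:: pos 1]; [:: pos 3]; [:: pos 4]; [:: pos 2]]
          [:: [:: pos (2,1); pos (3,2)]; [:: neg (2,0)]; [:: pos (3,0)];
              [:: neg (2,1)]; [:: pos (2,0); pos (3,1)]]];
  AlmostSplit 2 [:: pos 0] [:: pos 0]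
    [:: [:: pos (0,0)]; [:: pos (1,1)]; [:: pos (2,0)]; [:: pos (0,1)];
        [:: pos (1,0)]]
    [:: [:: neg (2,0); pos (2,1)]]
    [:: 8;16;24;8;16]
    [:: Arrow 6
          [:: [:: pos 1]; [:: neg 0]; [::]; [:: neg 1]; [:: pos 0]]
          [:: [:: pos (2,0)]; [:: pos (2,1)]];
        Arrow 28
          [:: [:: neg 0]; [:: pos 1]; [:: pos 2]; [:: pos 0; pos 3];
              [:: neg 1; neg 5]]
          [:: [:: pos (3,2)]; [:: pos (0,1); pos (2,0)]; [:: pos (0,2)];
              [:: pos (0,3); pos (2,1); neg (3,2)]; [:: neg (3,1)];
              [:: neg (0,1); neg (0,4)]; [:: pos (3,0)]]];
  AlmostSplit 2 [:: pos 1; neg 3] [:: pos 1]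
    [:: [:: pos (0,1)]; [:: pos (0,0)]; [:: neg (1,0); pos (2,1)];
        [:: neg (0,0); pos (1,1)]; [:: pos (1,0)]]
    [:: [:: pos (2,0)]]
    [:: 3;11;19;11;19]
    [:: Arrow 4
          [:: [::]; [::]; [:: neg 0]; [:: neg 1]; [::]]
          [:: [:: pos (2,0)]; [:: pos (2,1)]];
        Arrow 5
          [:: [::]; [:: neg 0]; [::]; [::]; [:: neg 1]]
          [:: [:: pos (1,0)]; [:: pos (0,2); neg (0,4); pos (2,0); pos (3,1)]];
        Arrow 26
          [:: [:: pos 2]; [:: pos 1]; [:: pos 0]; [:: pos 5]; [:: pos 0; pos 4]]
          [:: [:: pos (0,2); pos (2,0)]; [:: pos (0,3); pos (2,1); pos (3,2)];
              [:: pos (0,0)]; [:: pos (3,0)]; [:: pos (3,1)];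
              [:: pos (0,3); pos (2,1)]]];
  AlmostSplit 2 [:: pos 4] [:: pos 4]
    [:: [:: pos (1,0)]; [:: pos (1,1)]; [:: pos (2,0)]; [:: neg (1,0); pos (2,1)];
        [:: pos (0,0)]; [:: pos (0,1)]]
    [::]
    [:: 19;11;27;19;11;3]
    [:: Arrow 25
          [:: [:: neg 1]; [:: neg 2]; [:: neg 0]; [:: neg 3]; [:: neg 4]; [:: neg 5]]
          [:: [:: neg (1,0)]; [:: neg (0,0); neg (2,0)]; [:: neg (0,1); neg (3,0)];
              [:: neg (0,0); pos (1,1); neg (2,0)]; [:: neg (1,2)];
              [:: neg (0,5); pos (4,0)]];
        Arrow 26
          [:: [:: neg 0]; [:: neg 1]; [:: pos 3]; [:: neg 0; neg 4];
              [:: pos 1; neg 5]; [:: neg 2]]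
          [:: [:: pos (2,0)]; [:: pos (3,0)]; [:: neg (4,0)];
              [:: pos (0,2); neg (1,0)]; [:: pos (0,0); neg (0,3); neg (1,1)];
              [:: pos (2,1)]]];
  AlmostSplit 2 [:: pos 0] [:: pos 0]
    [:: [:: pos (0,0)]; [:: pos (1,0)]; [:: pos (2,1)]; [:: pos (0,1)];
        [:: neg (1,0); pos (1,1)]; [:: pos (2,0)]]
    [::]
    [:: 6;14;22;6;14;22]
    [:: Arrow 11
          [:: [:: pos 1]; [::]; [:: neg 0]; [:: neg 1]; [:: neg 2]; [:: pos 0]]
          [:: [:: pos (3,0)]; [:: pos (3,2)]; [:: pos (3,1)]];
        Arrow 29
          [:: [:: neg 0]; [:: pos 1; neg 2]; [:: pos 3]; [:: pos 4];
              [:: pos 1; pos 5]; [:: neg 6]]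
          [:: [:: pos (2,1)]; [:: pos (0,1); pos (2,0)]; [:: pos (2,0)];
              [:: pos (0,2); pos (3,0)]; [:: pos (0,3); pos (3,2)];
              [:: neg (0,1); pos (0,4); neg (2,0); pos (3,1)];
              [:: neg (0,5); pos (3,0)]]];
  AlmostSplit 2 [:: pos 4] [:: pos 4]
    [:: [:: pos (2,0)]; [:: pos (1,0)]; [:: pos (1,1)]; [:: neg (1,0); pos (2,1)];
        [:: pos (0,0)]; [:: pos (0,1)]]
    [::]
    [:: 26;18;10;18;10;2]
    [:: Arrow 9
          [:: [::]; [:: neg 0]; [:: neg 1]; [:: neg 0]; [::]; [:: neg 2]]
          [:: [:: neg (0,1); neg (1,0)]; [:: neg (0,2); neg (2,0)];
              [:: neg (0,5); pos (3,0)]];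
        Arrow 27
          [:: [:: pos 0]; [:: pos 1]; [:: pos 2]; [:: pos 4]; [:: pos 5]; [:: pos 3]]
          [:: [:: pos (0,0)]; [:: neg (1,0)]; [:: neg (2,0)]; [:: pos (3,0)];
              [:: neg (0,1); pos (0,3); neg (1,0)]; [:: neg (1,1); pos (2,0)]]];
  AlmostSplit 2 [:: pos 1; neg 5] [:: pos 1]
    [:: [:: pos (2,1)]; [:: pos (0,0)]; [:: pos (0,1)]; [:: pos (2,0)];
        [:: pos (1,0)]; [:: neg (0,0); pos (1,1)]]
    [::]
    [:: 18;10;2;26;18;10]
    [:: Arrow 20
          [:: [:: pos 1]; [:: neg 0]; [::]; [:: neg 4]; [:: neg 1; neg 3]; [:: pos 2]]
          [:: [:: pos (3,0)]; [:: neg (2,0)]; [:: neg (2,1)];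
              [:: neg (0,4); pos (1,1); pos (2,0)]; [:: neg (0,3); pos (1,0)]];
        Arrow 27
          [:: [:: neg 1]; [:: neg 2]; [:: neg 3]; [:: pos 0]; [:: pos 1; neg 4];
              [:: neg 2; neg 5]]
          [:: [:: pos (1,0)]; [:: neg (0,0); neg (2,0)];
              [:: neg (0,5); neg (1,2); neg (2,1)]; [:: neg (0,2)];
              [:: neg (0,0); neg (1,1); neg (2,0)]; [:: pos (1,2)]]];
  AlmostSplit 2 [:: pos 5] [:: pos 5]
    [:: [:: pos (2,0)]; [:: pos (1,0)]; [:: pos (1,1)]; [:: pos (0,1)];
        [:: neg (1,0); pos (2,1)]; [:: pos (0,0)]]
    [::]
    [:: 25;17;9;1;17;9]
    [:: Arrow 12
          [:: [::]; [:: pos 0]; [:: pos 1]; [:: pos 2]; [:: pos 0]; [::]]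
          [:: [:: pos (0,1); pos (1,0)]; [:: pos (0,2); pos (2,0)]; [:: pos (0,3)]];
        Arrow 21
          [:: [:: pos 2]; [:: pos 1]; [:: neg 0]; [::]; [:: neg 4]; [:: pos 0; pos 3]]
          [:: [:: pos (2,0)]; [:: neg (1,0)]; [:: pos (0,0)]; [:: neg (1,1)];
              [:: pos (0,1); neg (0,4); pos (1,0)]]];
  AlmostSplit 3 [:: pos 1; pos 4; pos 5] [:: pos 1]
    [:: [:: pos (0,1)]; [:: pos (0,0)]; [:: pos (2,2)]; [:: pos (0,2)];
        [:: pos (0,0); neg (1,1)]; [:: pos (0,0); neg (1,2)]; [:: pos (2,1)]]
    [:: [:: pos (1,0)]]
    [:: 7;15;23;7;15;15;23]
    [:: Arrow 16
          [:: [::]; [:: pos 1]; [:: pos 0]; [:: pos 3]; [::]; [:: neg 2]; [::]]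
          [:: [:: pos (4,0)]; [:: pos (2,0)]; [:: pos (4,1)]; [:: pos (4,2)]];
        Arrow 17
          [:: [:: neg 0]; [:: neg 1]; [::]; [::]; [:: pos 2]; [::]; [:: neg 3]]
          [:: [:: pos (4,2); pos (5,2)]; [:: neg (3,0)]; [:: pos (4,1); pos (5,1)];
              [:: pos (4,0); pos (5,0)]];
        Arrow 24
          [:: [:: pos 0]; [:: pos 1]; [:: pos 2]; [:: pos 3]; [:: neg 1; pos 4];
              [:: neg 4]; [:: pos 5]]
          [:: [:: pos (0,0); pos (4,2); pos (5,2)];
              [:: neg (0,4); neg (0,5); pos (5,1)]; [:: pos (0,2); neg (4,0)];
              [:: pos (0,3); neg (4,2)]; [:: neg (0,5); neg (4,1)];
              [:: pos (0,6); pos (4,0); pos (5,0)]]];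
  AlmostSplit 3 [:: pos 5] [:: pos 5]
    [:: [:: pos (0,1)]; [:: pos (1,2)]; [:: pos (1,1)]; [:: pos (1,0); neg (2,1)];
        [:: pos (0,2)]; [:: pos (0,0)]; [:: pos (2,1)]]
    [:: [:: neg (1,0); pos (2,1); pos (2,2)]]
    [:: 5;13;13;21;5;13;21]
    [:: Arrow 14
          [:: [:: pos 0]; [::]; [:: pos 1]; [::]; [::]; [::]; [:: pos 2]]
          [:: [:: pos (0,0); pos (4,2)]; [:: pos (0,2); pos (2,0)];
              [:: pos (0,6); pos (4,0)]];
        Arrow 18
          [:: [:: pos 0]; [:: pos 1]; [:: pos 1]; [:: pos 2]; [:: pos 0];
              [:: neg 1; pos 3]; [:: pos 2]]
          [:: [:: neg (4,2)]; [:: neg (2,0)]; [:: pos (3,0)]; [:: pos (3,1)]];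
        Arrow 19
          [:: [::]; [:: pos 0]; [::]; [:: pos 1]; [:: pos 2]; [:: neg 0; pos 3];
              [:: pos 1; neg 4]]
          [:: [:: pos (0,1); pos (2,0)]; [:: pos (0,3); neg (3,0)];
              [:: pos (0,4); pos (4,2)];
              [:: pos (0,1); pos (2,0); neg (3,1); neg (4,1)];
              [:: pos (0,3); pos (4,0)]]]].

End Data.

Lemma models_ok : all_ok models almost_splits.
Proof. exact: erefl. Qed.

(** * Coordinates and triangular maps *)

Section Columns.

Variable K : fieldType.

(** Coordinates are indexed by natural numbers and vanish out of range, since the
    tables refer to them by number. *)
Definition cof n (a : nat) (v : 'cV[K]_n) : K^o :=
  if insub a is Some i then v i 0 else 0.

Definition eps n (b : nat) : 'cV[K]_n := \col_i ((i : nat) == b)%:R.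

Lemma cof_ord n (i : 'I_n) (v : 'cV[K]_n) : cof i v = v i 0.
Proof. by rewrite /cof valK. Qed.

Lemma cof_out n a (v : 'cV[K]_n) : (n <= a)%N -> cof a v = 0 :> K.
Proof. by move=> na; rewrite /cof insubN // -leqNgt. Qed.

Lemma cof_linear n a : linear (@cof n a : 'cV[K]_n -> K^o).
Proof.
by move=> x v w; rewrite /cof; case: insubP => [i _ _|_]; rewrite ?mxE // scaler0 addr0.
Qed.

HB.instance Definition _ n a :=
  GRing.isLinear.Build K 'cV[K]_n K^o *:%R (@cof n a : 'cV[K]_n -> K^o) (@cof_linear n a).

Lemma cofZ n a x (v : 'cV[K]_n) : cof a (x *: v) = x * cof a v :> K.
Proof. exact: linearZ. Qed.

Lemma cof_inj n (v w : 'cV[K]_n) :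
  (forall a, (a < n)%N -> cof a v = cof a w) -> v = w.
Proof. by move=> e; apply/colP => i; rewrite -!cof_ord e. Qed.

Lemma cof_eps n a b : (a < n)%N -> cof a (eps n b) = (a == b)%:R :> K.
Proof. by move=> an; rewrite -[a]/(nat_of_ord (Ordinal an)) cof_ord mxE. Qed.

Lemma eps_basis n (v : 'cV[K]_n) : v = \sum_(b < n) (cof b v : K) *: eps n b.
Proof.
apply/colP => i; rewrite summxE (bigD1 i) //= big1 => [|j ij].
  by rewrite !mxE eqxx mulr1 addr0 cof_ord.
by rewrite !mxE [(i : nat) == j]eq_sym (inj_eq val_inj) (negPf ij) mulr0.
Qed.

Lemma cof_map n m (e : 'Hom('cV[K]_n, 'cV[K]_m)) v a :
  cof a (e v) = \sum_(b < n) cof b v * cof a (e (eps n b)) :> K.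
Proof.
rewrite {1}[v]eps_basis !linear_sum.
by apply: eq_bigr => b _; rewrite linearZ /= cofZ.
Qed.

(** Triangular for the filtration by [deg]; basis vectors of equal degree are
    not mixed, so that [d] is the diagonal whatever the order of the basis. *)
Definition triangular n (deg : nat -> nat) (d : nat -> K)
    (e : 'End('cV[K]_n)) :=
  forall a b, (a < n)%N -> (b < n)%N -> (deg a <= deg b)%N ->
    cof a (e (eps n b)) = d a *+ (a == b) :> K.

(** Each application of e - c increases by one the lowest degree in which a
    vector has a nonzero coordinate. *)
Lemma triangular_sole_eigenvalue n deg c (e : 'End('cV[K]_n)) :
  triangular deg (fun=> c) e -> sole_eigenvalue e c.
Proof.
move=> tri; exists (\max_(i < n) deg i).+1 => x.
set h := fun y : 'cV[K]_n => e y - c *: y.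
have low m a : (a < n)%N -> (deg a < m)%N -> cof a (iter m h x) = 0.
  elim: m a => // m IH a an am; rewrite iterS /h linearB /= cofZ cof_map.
  rewrite (bigD1 (Ordinal an)) //= tri // eqxx mulr1n [_ * c]mulrC addrAC subrr add0r.
  apply: big1 => b ba; have [ab|ba'] := leqP (deg a) (deg b).
    by rewrite tri // -[a]/(nat_of_ord (Ordinal an)) val_eqE eq_sym (negPf ba) mulr0n mulr0.
  by rewrite IH ?mul0r // (leq_trans ba').
apply: cof_inj => a an; rewrite linear0 low // ltnS.
exact: (@leq_bigmax _ (fun i : 'I_n => deg i) (Ordinal an)).
Qed.

End Columns.

(** * Endomorphisms of the listed representations *)

Section Model.

Variable K : fieldType.
Variable u : model.

Definition model_dimvec : seq (nat * nat) :=
  mkseq (fun d => (count (pred1 d) (take (msrc u) (mdeg u)),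
                   count (pred1 d) (take (mtgt u) (mdeg u))))
        (foldr maxn 0%N (mdeg u)).+1.

Definition model_item : item K :=
  @Item K (msrc u) (mtgt u) model_dimvec
    (\sum_(t <- mloop u) t.2%:~R *: E t.1.1.+1 t.1.2.+1).

Definition model_rep : rep K := item_rep model_item.

Hypothesis uok : model_ok u.

Lemma model_arrE (x : rsp1 model_rep) a :
  (a < mtgt u)%N -> cof a (rarr model_rep x) = cof a x.
Proof.
move=> aN; rewrite lfunE /= -{1}[a]/(nat_of_ord (Ordinal aN)) cof_ord mxE.
have [am|am] := ltnP a (msrc u).
  rewrite (bigD1 (Ordinal am)) //= !mxE /= eqxx am mul1r big1 => [|j ja].
    by rewrite addr0 -cof_ord.
  by rewrite mxE /= -[a]/(nat_of_ord (Ordinal am)) val_eqE eq_sym (negPf ja) mul0r.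
rewrite cof_out // big1 // => j _; rewrite mxE /=.
by rewrite [(a < _)%N]ltnNge am andbF mul0r.
Qed.

Lemma mloopP p : p \in mloop u -> 
  [/\ p.1.1 < mtgt u, p.1.2 < mtgt u & mdegree u p.1.1 = (mdegree u p.1.2).+1]%N.
Proof. by move: uok => /and5P[_ _ _ /allP h _] /h /and3P[? ? /eqP]. Qed.

Lemma model_loop_entry p (v : 'cV[K]_(mtgt u)) : p \in mloop u ->
  (p.2%:~R *: E p.1.1.+1 p.1.2.+1) *m v =
  (cof p.1.2 v : K) *: eps K (mtgt u) p.1.1 *~ p.2.
Proof.
move=> /mloopP[p1 p2 _]; rewrite -scalemxAl scaler_int; congr (_ *~ _).
apply/colP => i; rewrite !mxE (bigD1 (Ordinal p2)) //= !mxE /= !eqSS eqxx andbT.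
rewrite big1 ?addr0 => [|j jp]; last first.
  by rewrite mxE !eqSS -[p.1.2]/(nat_of_ord (Ordinal p2)) val_eqE (negPf jp) andbF mul0r.
by rewrite -cof_ord mulrC.
Qed.

Lemma model_loopv (v : rsp2 model_rep) : rloop model_rep v =
  \sum_(p <- mloop u) (cof p.1.2 v : K) *: eps K (mtgt u) p.1.1 *~ p.2.
Proof.
by rewrite lfunE /= mulmx_suml; apply: eq_big_seq => p /model_loop_entry.
Qed.

Lemma model_loop_eps b :
  rloop model_rep (eps K (mtgt u) b) = feval (@eps K (mtgt u)) (mcol u b).
Proof.
rewrite model_loopv /feval /mcol big_map big_filter [RHS]big_mkcond /=.
apply: eq_big_seq => p /mloopP[p1 p2 _].
by rewrite cof_eps //; case: eqP => _; rewrite ?scale1r // scale0r mul0rz.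
Qed.

Lemma model_loopE (v : rsp2 model_rep) a :
  cof a (rloop model_rep v) = feval (fun b : nat => cof b v) (mrow u a).
Proof.
rewrite model_loopv linear_sum /feval /mrow big_map big_filter [RHS]big_mkcond /=.
apply: eq_big_seq => p /mloopP[p1 p2 _]; rewrite raddfMz /= cofZ.
have [aN|aN] := ltnP a (mtgt u).
  by rewrite cof_eps // eq_sym; case: eqP => _; rewrite ?mulr1 // mulr0 mul0rz.
rewrite [cof a _]cof_out // mulr0 mul0rz; case: eqP => // e.
by move: p1; rewrite e ltnNge aN.
Qed.

Lemma model_arr_eps b : (b < msrc u)%N ->
  rarr model_rep (eps K (msrc u) b) = eps K (mtgt u) b.
Proof.
move=> bm; apply: cof_inj => a /= aN; rewrite model_arrE // [RHS]cof_eps //.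
have [am|am] := ltnP a (msrc u); first by rewrite cof_eps.
rewrite [LHS]cof_out //; case: (a =P b) => // e.
by move: bm; rewrite -e ltnNge am.
Qed.

Lemma model_bound : rbound model_rep.
Proof.
have /and5P[_ _ _ _ /allP cube] := uok.
have loop2 (v : rsp2 model_rep) g :
    feval (fun b : nat => cof b (rloop model_rep v)) g =
    feval (fun b : nat => cof b v) (fsubst (mrow u) g).
  by rewrite feval_subst; apply: eq_feval => p _; rewrite model_loopE.
move=> v; apply: cof_inj => a /= aN; rewrite linear0 model_loopE !loop2.
have := cube a; rewrite mem_iota => /(_ aN) /nilP ->; exact: feval0.
Qed.

Lemma model_nonzero : ~ rzero model_rep.
Proof.
case=> /dim_eq0P z1 /dim_eq0P z2.
have /and5P[_ + _ _ _] := uok; rewrite /mdim leq_max => /orP[m0|n0].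
  have /(congr1 (cof 0)) := z1 (eps K (msrc u) 0).
  by rewrite cof_eps // linear0 => /eqP; rewrite oner_eq0.
have /(congr1 (cof 0)) := z2 (eps K (mtgt u) 0).
by rewrite cof_eps // linear0 => /eqP; rewrite oner_eq0.
Qed.

Lemma pairsP n a b : ((a, b) \in pairs n) = (a < n)%N && (b < n)%N.
Proof.
apply/allpairsP/andP => [[[x y] /= [+ + [-> ->]]]|[an bn]].
  by rewrite !mem_iota.
by exists (a, b); rewrite !mem_iota.
Qed.

(** If the second space is not zero, the second component of an endomorphism
    determines the first one, as the arrow is injective. *)
Definition entry (e1 : 'End(rsp1 model_rep)) (e2 : 'End(rsp2 model_rep))
    (p : nat * nat) : K :=
  if mtgt u == 0%N then cof p.1 (e1 (eps K (msrc u) p.2))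
  else cof p.1 (e2 (eps K (mtgt u) p.2)).

(** The equations e N = N e and e (im f) <= im f force the claimed shape by
    elimination; this is what [brick_ok] has computed. *)
Lemma brick_endo s e1 e2 : brick_ok u s -> @rhom _ model_rep model_rep e1 e2 ->
  exists c, [/\ triangular (mdegree u) (fun=> c) e1,
    triangular (mdegree u) (fun=> c) e2
    & (0 < mtgt u)%N ->
      feval (fun a : nat => cof a (e2 (feval (@eps K (mtgt u)) (as_elt s)))) (as_fun s) = c].
Proof.
move=> bok [ef el]; set ev := entry e1 e2.
have /and5P[small dim0 _ _ _] := uok.
have hyps h : h \in end_hyps u -> feval ev h = 0 :> K^o.
  rewrite mem_cat => /orP[] /mapP[[a b]].
    rewrite pairsP => /andP[aN bN] ->; have N0 : (mtgt u == 0%N) = false by case: (mtgt u) aN.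
    rewrite /comm_form feval_cat /ev /entry N0 /=.
    have -> : feval (fun p => cof p.1 (e2 (eps K (mtgt u) p.2))) [seq ((a, p.1), p.2) | p <- mcol u b]
            = cof a (e2 (rloop model_rep (eps K (mtgt u) b))).
      by rewrite model_loop_eps !raddf_feval /= /feval big_map.
    have -> : feval (fun p => cof p.1 (e2 (eps K (mtgt u) p.2))) [seq ((p.1, b), - p.2) | p <- mrow u a]
            = - cof a (rloop model_rep (e2 (eps K (mtgt u) b))).
      rewrite model_loopE /feval big_map -sumrN /=.
      by apply: eq_bigr => p _; rewrite mulrNz.
    by rewrite el subrr.
  rewrite mem_filter pairsP /= => /andP[/andP[bm am] /andP[aN bN]] ->.
  have N0 : (mtgt u == 0%N) = false by case: (mtgt u) aN.
  rewrite feval1 /ev /entry N0 /= -model_arr_eps // ef.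
  by rewrite model_arrE // cof_out.
have concl := entails_eq0 (V := K^o) bok hyps.
have tri a b : (a < mdim u)%N -> (b < mdim u)%N ->
    (mdegree u a <= mdegree u b)%N -> ev (a, b) = ev (0%N, 0%N) *+ (a == b).
  move=> an bn ab.
  have gin : (if a == b then [:: ((a, b), 1%R); ((0%N, 0%N), (-1)%R)]
              else [:: ((a, b), 1%R)]) \in tri_goals u.
    by apply/mapP; exists (a, b) => //; rewrite mem_filter ab pairsP an bn.
  have gin' : (if a == b then [:: ((a, b), 1%R); ((0%N, 0%N), (-1)%R)]
              else [:: ((a, b), 1%R)]) \in
     if mtgt u == 0%N then tri_goals u else trace_form s :: tri_goals u.
    by case: (mtgt u == 0%N); rewrite ?inE gin ?orbT.
  have := concl _ gin'; case: (a =P b) => [->|_].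
    by rewrite !feval_cons feval0 addr0 mulrNz => /eqP; rewrite addr_eq0 opprK => /eqP.
  by rewrite feval1.
exists (ev (0%N, 0%N)); split.
- move=> a b /= am bm ab; have am' := leq_trans am (leq_maxl _ (mtgt u)).
  have bm' := leq_trans bm (leq_maxl _ (mtgt u)).
  rewrite -tri // /ev /entry /=; case: (boolP (mtgt u == 0%N)) => [//|N0].
  move: small; rewrite (negPf N0) orbF => small.
  rewrite -model_arr_eps // ef model_arrE // (leq_trans am) //.
- move=> a b /= aN bN ab; have aN' := leq_trans aN (leq_maxr (msrc u) _).
  have bN' := leq_trans bN (leq_maxr (msrc u) _).
  have N0 : (mtgt u == 0%N) = false by case: (mtgt u) aN.
  by rewrite -tri // /ev /entry N0.
- move=> N_gt0; have N0 : (mtgt u == 0%N) = false by case: (mtgt u) N_gt0.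
  have := concl (trace_form s); rewrite N0 mem_head => /(_ isT).
  rewrite /trace_form feval_cons mulrNz mulr1z addrC => /eqP; rewrite subr_eq0 => /eqP <-.
  rewrite /feval big_allpairs_dep; apply: eq_bigr => p _ /=.
  rewrite !linear_sum /= mulrz_suml; apply: eq_bigr => r _ /=.
  by rewrite /ev /entry N0 /= !raddfMz /= mulrC mulrzA.
Qed.

End Model.

(** * Splitting off a representation or extending maps *)

Section Family.

Variables (K : fieldType) (M : rep K).
Hypothesis Mbound : rbound M.

Let f := rarr M.
Let phi := rloop M.

Lemma iter_phi_linear d : linear (fun x => iter d phi x).
Proof. by elim: d => // d IH a x y; rewrite /= IH linearP. Qed.

Lemma iter_phi_big d x : (2 < d)%N -> iter d phi x = 0.
Proof.
move=> d2; rewrite -(subnK d2) iterD /= [phi (phi _)]Mbound.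
by elim: (d - 3)%N => //= n ->; rewrite linear0.
Qed.

(** A homomorphism from the representation [u] to M, given by the images [y] of
    the basis vectors of its second space. *)
Definition model_hom (u : model) (y : nat -> rsp2 M) :=
  (forall b, phi (y b) = feval y (mcol u b)) /\
  (forall a, (a < msrc u)%N -> y a \in limg f).

(** The values in M of the symbols of the push-out E. *)
Definition push_val (y z : nat -> rsp2 M) (k : nat * nat) : rsp2 M :=
  if k.1 == 0%N then y k.2 else iter k.2 phi (z k.1.-1).

(** The pair (y, z) factors through the relations of E: it is a map E -> M that
    restricts to y on U. *)
Definition push_sol (u : model) (s : almost_split) (y z : nat -> rsp2 M) :=
  (forall r, (r < as_width s)%N -> feval (push_val y z) (push_rel u s r) = 0) /\
  (forall a, (a < size (as_coord s) - msrc u)%N -> z a \in limg f).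

Lemma push_relE u s y z r : feval (push_val y z) (push_rel u s r) =
  - (if r == 0%N then feval y (as_elt s) else 0) +
  \sum_(i < size (tests u s)) feval (fun d => iter d phi (z i))
                               (test_comp (nth [::] (tests u s) i) r).
Proof.
rewrite /push_rel feval_cat; congr (_ + _).
  case: eqP => _; last by rewrite feval0 oppr0.
  rewrite /feval big_map -sumrN; apply: eq_bigr => p _.
  by rewrite /push_val /= mulrNz.
rewrite -(big_mkord xpredT (fun i => feval (fun d => iter d phi (z i))
  (test_comp (nth [::] (tests u s) i) r))) /index_iota subn0.
rewrite /feval big_flatten big_map; apply: eq_bigr => i _.
by rewrite big_map.
Qed.

Section Dual.

Variables (u : model) (s : almost_split) (y : nat -> rsp2 M).
Hypothesis uok : model_ok u.
Hypothesis bok : brick_ok u s.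
Hypothesis dok : dual_ok u s.
Hypothesis N_gt0 : (0 < mtgt u)%N.
Hypothesis sz : size (as_coord s) = mtgt u.
Hypothesis elt_ok : all (fun p => p.1 < mtgt u)%N (as_elt s).
Hypothesis fam : model_hom u y.
Hypothesis Mi : rindec M.

Lemma model_hom_extend : exists g1 g2, @rhom _ (model_rep K u) M g1 g2 /\
  forall b, (b < mtgt u)%N -> g2 (eps K (mtgt u) b) = y b.
Proof.
have [yl yf] := fam.
have small : (msrc u <= mtgt u)%N.
  by have /and5P[] := uok; rewrite eqn0Ngt N_gt0 orbF.
have /fin_all_exists[x xE] (i : 'I_(msrc u)) : exists x, f x = y i.
  by have /memv_imgP[x _ ->] := yf i (ltn_ord i); exists x.
have [g1 g1E] : exists g : 'Hom('cV[K]_(msrc u), rsp1 M),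
    g =1 (fun v => \sum_(i < msrc u) (cof i v : K) *: x i).
  apply: linear_lfun => a v w; rewrite scaler_sumr -big_split /=.
  by apply: eq_bigr => i _; rewrite linearP /= scalerDl scalerA.
have [g2 g2E] : exists g : 'Hom('cV[K]_(mtgt u), rsp2 M),
    g =1 (fun v => \sum_(i < mtgt u) (cof i v : K) *: y i).
  apply: linear_lfun => a v w; rewrite scaler_sumr -big_split /=.
  by apply: eq_bigr => i _; rewrite linearP /= scalerDl scalerA.
have g2eps b : (b < mtgt u)%N -> g2 (eps K (mtgt u) b) = y b.
  move=> bN; rewrite g2E (bigD1 (Ordinal bN)) //= cof_eps // eqxx scale1r.
  rewrite big1 ?addr0 // => i; rewrite -val_eqE /= => ib.
  by rewrite cof_eps // (negPf ib) scale0r.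
exists g1, g2; split=> //; split=> v.
  rewrite g1E g2E linear_sum /=.
  under [RHS]eq_bigr => i _ do rewrite linearZ /= xE.
  rewrite -(big_mkord xpredT (fun i => (cof i v : K) *: y i)).
  rewrite -(big_mkord xpredT (fun i => (cof i (rarr (model_rep K u) v) : K) *: y i)).
  rewrite (big_cat_nat (n := msrc u)) //=.
  rewrite [X in _ + X]big1_seq => [|i /= ]; last first.
    rewrite mem_index_iota => /andP[mi iN].
    by rewrite -[linfun _]/(rarr (model_rep K u)) model_arrE // cof_out // scale0r.
  rewrite addr0 big_nat [RHS]big_nat; apply: eq_bigr => i /andP[_ im].
  by rewrite -[linfun _]/(rarr (model_rep K u)) model_arrE // (leq_trans im).
rewrite [v in LHS]eps_basis [v in RHS]eps_basis !linear_sum /=.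
apply: eq_bigr => b _; rewrite !linearZ /= g2eps // -/phi yl model_loop_eps //.
congr (_ *: _); rewrite raddf_feval; apply: eq_feval => p /=.
by case/mapP => t; rewrite mem_filter => /andP[_ /(mloopP uok)[tN _ _]] -> /=; apply: g2eps.
Qed.

(** The Auslander-Reiten formula in explicit form.  Extending y to E is a linear
    system for z in M.  If it has no solution, a functional on the q-th power of
    the second space of M kills the image of the system but not its right-hand
    side.  Its components w_r satisfy the equations that cut U out of its
    injective hull, so they define a homomorphism h from M to U.  The scalar part
    of the composite h y is the value of the functional at the right-hand side,
    hence nonzero, and U splits off from M. *)
Lemma almost_split_or : riso M (model_rep K u) \/ exists z, push_sol u s y z.
Proof.
pose q := as_width s; pose W := {ffun 'I_q -> rsp2 M}.
pose nt := size (tests u s); pose mc := (size (as_coord s) - msrc u)%N.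
have /fin_all_exists[A AE] (i : 'I_nt) : exists A : 'Hom(rsp2 M, W), forall x, A x =
    [ffun r : 'I_q => feval (fun d => iter d phi x) (test_comp (nth [::] (tests u s) i) r)].
  apply: linear_lfun => a x x'; apply/ffunP => r; rewrite !ffunE /feval scaler_sumr -big_split /=.
  by apply: eq_bigr => p _; rewrite iter_phi_linear mulrzDl -scalerMzr.
(* The unknowns of the first tests range over the image of the arrow. *)
pose Vs (i : 'I_nt) : {vspace rsp2 M} := if (i < mc)%N then limg f else fullv.
pose t : W := [ffun r : 'I_q => if r == 0%N :> nat then feval y (as_elt s) else 0].
have [/memv_sumP[v vV tE]|tU] := boolP (t \in (\sum_i A i @: Vs i)%VS).
  right.
  have /fin_all_exists[x xE] i : exists x, x \in Vs i /\ A i x = v i.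
    by have /memv_imgP[x xV ->] := vV i isT; exists x.
  exists (fun n => if insub n is Some i then x i else 0); split=> [r rq|a am].
    rewrite push_relE; have /ffunP/(_ (Ordinal rq)) := tE.
    rewrite !ffunE sum_ffunE /= => ->; rewrite addrC; apply/eqP; rewrite subr_eq0; apply/eqP.
    by apply: eq_bigr => i _; rewrite valK -(xE i).2 AE ffunE.
  case: insubP => [i _ ia|_]; last by rewrite mem0v.
  by have := (xE i).1; rewrite /Vs ia am.
left; have [w0 [w0t w0U]] := separating_functional tU.
have w0A i x : x \in Vs i -> w0 (A i x) = 0.
  by move=> xV; apply: w0U; apply: (subvP (sumv_sup i _ (subvv _))) => //; apply: memv_img.
(* The r-th component of the functional. *)
pose w r x : K^o := w0 [ffun r' : 'I_q => x *+ (r' == r :> nat)].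
have w_lin r : linear (w r).
  move=> a x x'; rewrite /w -linearP; congr (w0 _).
  by apply/ffunP => r'; rewrite !ffunE mulrnDl scalerMnr.
have w_0 r : w r 0 = 0.
  by rewrite /w -[RHS](linear0 w0); congr (w0 _); apply/ffunP => r'; rewrite !ffunE mul0rn.
(* The value at x of the functional w_r o loop^d that the symbol (d, r) stands for. *)
pose sg x (k : nat * nat) : K^o := w k.2 (iter k.1 phi x).
have sg_lin k : linear (sg^~ k) by move=> a x x'; rewrite /sg iter_phi_linear w_lin.
have sg_shift x g : feval (sg x) (fshift g) = feval (sg (phi x)) g.
  rewrite /feval big_map big_filter big_mkcond; apply: eq_bigr => p _ /=.
  rewrite /sg -iterSr; case: ltnP => // p2.
  by rewrite iter_phi_big ?ltnS // w_0 mul0rz.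
have sg_test (i : 'I_nt) x : x \in Vs i -> feval (sg x) (nth [::] (tests u s) i) = 0.
  move=> /w0A <-; rewrite AE.
  transitivity (w0 (feval (fun k => [ffun r' : 'I_q => iter k.1 phi x *+ (r' == k.2 :> nat)])
                          (nth [::] (tests u s) i))).
    by rewrite raddf_feval.
  congr (w0 _); apply/ffunP => r; rewrite ffunE /feval sum_ffunE /test_comp big_map big_filter.
  rewrite [RHS]big_mkcond /=; apply: eq_bigr => p _.
  by rewrite ffunMzE ffunE eq_sym; case: eqP => _; rewrite ?mulr1n // mulr0n mul0rz.
have sg_rel x h : h \in rel_forms s -> feval (sg x) h = 0.
  have rel0 x' g : g \in as_rel s -> feval (sg x') g = 0.
    move=> gin; have gi : (index g (as_rel s) < size (as_rel s))%N by rewrite index_mem.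
    have it : (size (drop (msrc u) (as_coord s)) + index g (as_rel s) < nt)%N.
      by rewrite /nt /tests size_cat ltn_add2l.
    have := @sg_test (Ordinal it) x'; rewrite /Vs /= size_drop ltnNge leq_addr memvf => /(_ isT).
    by rewrite /tests nth_cat -size_drop ltnNge leq_addr /= addKn nth_index.
  rewrite !mem_cat => /or3P[/rel0 //|/mapP[g gin ->]|/mapP[g gin ->]].
    by rewrite sg_shift rel0.
  by rewrite /= !sg_shift rel0.
have sg_dual x := entails_eq0 (V := K^o) dok (sg_rel x).
have sg_img x a : (msrc u <= a < mtgt u)%N -> feval (sg (f x)) (acoord s a) = 0.
  move=> /andP[ma aN]; have am : (a - msrc u < mc)%N by rewrite /mc sz ltn_sub2r // (leq_ltn_trans ma).
  have it : (a - msrc u < nt)%N by rewrite /nt /tests size_cat size_drop ltn_addr.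
  have := @sg_test (Ordinal it) (f x); rewrite /Vs /= am memv_img ?memvf // => /(_ isT).
  by rewrite /tests nth_cat size_drop am nth_drop subnKC.
(* The coordinates of h x in U, by their expressions in the functionals. *)
have [h2 h2E] : exists h : 'Hom(rsp2 M, 'cV[K]_(mtgt u)),
    h =1 (fun x => \col_a feval (sg x) (acoord s a)).
  apply: linear_lfun => a x x'; apply/colP => i; rewrite !mxE /feval mulr_sumr -big_split /=.
  by apply: eq_bigr => p _; rewrite sg_lin mulrzDl -mulrzAr.
have h2c x a : cof a (h2 x) = feval (sg x) (acoord s a).
  have [aN|aN] := ltnP a (mtgt u).
    by rewrite h2E -{1}[a]/(nat_of_ord (Ordinal aN)) cof_ord mxE.
  by rewrite cof_out // /acoord nth_default ?sz // feval0.
have [h1 h1E] : exists h : 'Hom(rsp1 M, 'cV[K]_(msrc u)),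
    h =1 (fun x => \col_(a < msrc u) (cof a (h2 (f x)) : K)).
  by apply: linear_lfun => a x x'; apply/colP => i; rewrite !mxE !linearP.
have h_hom : @rhom _ M (model_rep K u) h1 h2.
  split=> x; apply: cof_inj => a /= aN.
    rewrite model_arrE // h1E; have [am|am] := ltnP a (msrc u).
      by rewrite -[a in RHS]/(nat_of_ord (Ordinal am)) cof_ord mxE.
    by rewrite [RHS]cof_out // h2c sg_img // am.
  rewrite model_loopE // -/phi h2c -sg_shift.
  have := sg_dual x (loop_goal u s a).
  rewrite inE map_f ?mem_iota ?orbT // => /(_ isT) /eqP.
  rewrite /loop_goal feval_muladd mulrNz mulr1z addrC subr_eq0 feval_subst => /eqP <-.
  by apply: eq_feval => p _; rewrite h2c.
have [g1 [g2 [g_hom g2eps]]] := model_hom_extend.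
(* The scalar part of h g is the value of w_0 at the socle vector. *)
have [c [t1 t2 cE]] := brick_endo uok bok (rhom_comp g_hom h_hom).
apply: (indec_summand_iso Mi (model_nonzero uok) g_hom h_hom
  (triangular_sole_eigenvalue t1) (triangular_sole_eigenvalue t2)).
rewrite -cE // comp_lfunE.
have -> : g2 (feval (@eps K (mtgt u)) (as_elt s)) = feval y (as_elt s).
  rewrite raddf_feval; apply: eq_feval => p /(allP elt_ok) pN; exact: g2eps.
set x := feval y _.
rewrite (eq_feval (v' := fun a => feval (sg x) (acoord s a))) => [|p _]; last exact: h2c.
rewrite -feval_subst.
have := sg_dual x (fmuladd (-1) (fsubst (acoord s) (as_fun s)) [:: ((0%N, 0%N), 1%R)]).
rewrite mem_head => /(_ isT) /eqP.
rewrite feval_muladd mulrNz mulr1z addrC subr_eq0 feval1 => /eqP <-.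
rewrite /sg /w /=; apply: contraNneq w0t => e; rewrite -e; apply/eqP; congr (w0 _).
by apply/ffunP => r; rewrite !ffunE; case: eqP.
Qed.

End Dual.

End Family.

Section Factor.

Variables (K : fieldType) (M : rep K).
Hypothesis Mbound : rbound M.

Let f := rarr M.
Let phi := rloop M.

(** [push_loop] is the loop of E. *)
Lemma push_loop_val u y z g : model_hom (M := M) u y ->
  phi (feval (push_val y z) g) = feval (push_val y z) (fsubst (push_loop u) g).
Proof.
move=> [yl _]; rewrite feval_subst raddf_feval; apply: eq_feval => -[[k1 k2] x] _ /=.
rewrite /push_val /push_loop /=; case: (boolP (k1 == 0%N)) => [_|k1_0].
  by rewrite [phi _]yl /feval [RHS]big_map.
case: ltnP => k2_2; first by rewrite feval1 /= (negPf k1_0).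
by rewrite feval0 -[LHS]/(iter k2.+1 phi _) iter_phi_big.
Qed.

Section Arrows.

Variables (ms : seq model) (u : model) (s : almost_split) (y z : nat -> rsp2 M).
Hypothesis fok : factor_ok ms u s.
Hypothesis fam : model_hom (M := M) u y.
Hypothesis zP : push_sol u s y z.

Let tau := push_val y z.

Lemma push_rels0 h : h \in push_rels u s -> feval tau h = 0.
Proof.
have rel0 g : g \in [seq push_rel u s r | r <- iota 0 (as_width s)] -> feval tau g = 0.
  by case/mapP => r; rewrite mem_iota => rq ->; apply: zP.1.
have rel1 g : g \in map (fsubst (push_loop u)) [seq push_rel u s r | r <- iota 0 (as_width s)] ->
    feval tau g = 0.
  by case/mapP => g' /rel0 g0 ->; rewrite -(push_loop_val _ _ fam) [feval _ _]g0 linear0.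
rewrite !mem_cat => /or3P[/rel0|/rel1|] //.
by case/mapP => g' /rel1 g0 ->; rewrite -(push_loop_val _ _ fam) [feval _ _]g0 linear0.
Qed.

Definition arrow_img (x : arrow) (b : nat) : rsp2 M := feval tau (arrow_incl x b).

Lemma arrow_hom x : x \in as_arrows s -> model_ok (nmodel ms (arrow_to x)) ->
  model_hom (M := M) (nmodel ms (arrow_to x)) (arrow_img x).
Proof.
move=> xs tok; case/andP: fok => eok /allP/(_ x xs)/andP[/eqP sx sok].
split=> [b|a am].
  rewrite /arrow_img -/phi (push_loop_val _ _ fam).
  have [bN|bN] := ltnP b (mtgt (nmodel ms (arrow_to x))).
    have := entails_eq0 eok push_rels0 (g := hom_goal ms u x b).
    rewrite mem_cat (allpairs_f_dep (hom_goal ms u)) ?mem_iota // orbT => /(_ isT) /eqP.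
    by rewrite feval_muladd mulrNz mulr1z addrC subr_eq0 => /eqP <-; rewrite feval_subst.
  rewrite {1}/arrow_incl nth_default ?sx // feval0 /mcol.
  rewrite (eq_in_filter (a2 := pred0)) ?filter_pred0 ?feval0 // => p /(mloopP tok)[_ pN _].
  by apply: contraTF bN => /eqP <-; rewrite -ltnNge.
rewrite /arrow_img /arrow_incl; have [an|an] := ltnP a (size (arrow_incls x)); last first.
  by rewrite nth_default // feval0 mem0v.
apply: (entails_sound (v := tau) (H := limg f) sok); last first.
  rewrite -(nth_take _ am) mem_nth // size_take; by case: ifP.
move=> h; rewrite mem_cat => /orP[/push_rels0 ->|]; first by rewrite mem0v.
rewrite mem_cat => /orP[] /mapP[b]; rewrite mem_iota => /= bm ->; rewrite feval1.
  by have [_ /(_ b bm)] := fam.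
by have [_ /(_ b bm)] := zP.
Qed.

(** The map y factors through the sum of the representations X that are targets
    of arrows, by way of E. *)
Lemma arrow_sum a : (a < mtgt u)%N ->
  y a = \sum_(x <- as_arrows s) feval (arrow_img x) (arrow_proj x a).
Proof.
move=> aN; case/andP: fok => eok _.
have := entails_eq0 eok push_rels0 (g := sum_goal s a).
rewrite mem_cat map_f ?mem_iota // => /(_ isT).
rewrite /sum_goal; set t := [:: _].
have -> l : feval tau (foldr (fun x h => fmuladd 1 (fsubst (arrow_incl x) (arrow_proj x a)) h) t l)
       = \sum_(x <- l) feval (arrow_img x) (arrow_proj x a) - y a.
  elim: l => [|x l IH] /=.
    by rewrite big_nil add0r feval_cons feval0 addr0 mulrNz mulr1z.
  by rewrite feval_muladd mulr1z IH feval_subst big_cons addrA.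
by move/eqP; rewrite subr_eq0 => /eqP.
Qed.

End Arrows.

End Factor.

(** * Completeness of the list *)

Section Classification.

Variables (K : fieldType) (M : rep K).
Hypothesis Mbound : rbound M.
Hypothesis Mindec : rindec M.

Variables (ms : seq model) (ss : seq almost_split).
Hypothesis ok : all_ok ms ss.

Definition is_model := exists2 k, (k < size ms)%N & riso M (model_rep K (nmodel ms k)).

(** Unless M is in the list, every map U -> M is a sum of composites
    U -> X -> M, in which each basis vector of U is replaced by basis vectors of
    smaller height.  Induction on the height shows that it is zero. *)
Lemma all_hom0 : ~ is_model -> forall k a y, (k < size ms)%N ->
  (a < mtgt (nmodel ms k))%N -> model_hom (M := M) (nmodel ms k) y -> y a = 0.
Proof.
move=> nM k a y; have [n] := ubnP (height ss k a).
elim: n => // n IH in k a y * => hn kms aN fam.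
have mok l : (l < size ms)%N -> model_ok (nmodel ms l).
  by move=> lms; have /allP/(_ l) := ok; rewrite mem_iota => /(_ lms)/and3P[].
have /allP/(_ k) := ok; rewrite mem_iota => /(_ kms)/and3P[uok bok].
have N_gt0 : (0 < mtgt (nmodel ms k))%N by apply: leq_ltn_trans aN.
rewrite eqn0Ngt N_gt0 /= => /and5P[/eqP sz eltok dok fok hok].
have [iso|[z zP]] := almost_split_or Mbound uok bok dok N_gt0 sz eltok fam Mindec.
  by case: nM; exists k.
rewrite (arrow_sum Mbound fok fam zP aN) big_seq big1 // => x xs.
have := allP hok x xs; case/andP => lms /allP/(_ a); rewrite mem_iota => /(_ aN)/allP hx.
rewrite /feval big_seq big1 // => p /hx /andP[pN ph].
rewrite (IH (arrow_to x) p.1 _ _ lms pN (arrow_hom Mbound fok fam zP xs (mok _ lms))) ?mul0rz //.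
exact: leq_trans ph _.
Qed.

End Classification.

(** The eighth representation K[x]/(x^3) is projective, generated by its first
    basis vector. *)
Lemma projective_hom (K : fieldType) (M : rep K) (x : rsp2 M) : rbound M ->
  model_hom (M := M) (nmodel models 7%N) (fun a => if (a < 3)%N then iter a (rloop M) x else 0).
Proof.
move=> Mb; split=> // b; case: b => [|[|[|b]]]; rewrite /mcol /= ?feval1 ?feval0 ?linear0 //.
Qed.

(** If M is not in the list, its second space is zero by [all_hom0].  Then any
    nonzero vector of the first space spans a summand K -> 0. *)
Lemma classification (K : fieldType) (M : rep K) : rbound M -> rindec M ->
  exists2 k, (k < size models)%N & riso M (model_rep K (nmodel models k)).
Proof.
move=> Mb Mi; apply: contrapT => nM.
have M2 (x : rsp2 M) : x = 0.
  exact: (all_hom0 Mb Mi models_ok nM (k := 7%N) (a := 0%N) isT isT (projective_hom x Mb)).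
case: nM; exists 2%N => //.
have [x x0] : exists x : rsp1 M, x != 0.
  apply: contrapT => nx; case: Mi => + _; apply; apply/rzeroP; split=> // x.
  by apply/eqP; apply: contrapT => /negP x0; apply: nx; exists x.
have [|h0 [h0x _]] := separating_functional (U := 0%VS) (y := x); first by rewrite memv0.
set X := model_rep K _.
have X2 (v : rsp2 X) : v = 0 by apply: cof_inj.
have [h1 h1E] : exists h : 'Hom(rsp1 M, rsp1 X), h =1 (fun y => (h0 y : K) *: eps K 1 0).
  by apply: linear_lfun => a y y'; rewrite linearP /= scalerDl scalerA.
have [g1 g1E] : exists g : 'Hom(rsp1 X, rsp1 M), g =1 (fun v => (cof 0 v : K) *: x).
  by apply: linear_lfun => a y y'; rewrite linearP /= scalerDl scalerA.
have hg : @rhom _ X M g1 0%VF by split=> v; rewrite ?[RHS]M2 [LHS]M2.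
have hh : @rhom _ M X h1 0%VF by split=> v; rewrite [LHS]X2 [RHS]X2.
have uok : model_ok (nmodel models 2%N) by [].
apply: (indec_summand_iso (c := (h0 x : K)) Mi (model_nonzero (K := K) uok) hg hh) => //.
  exists 1%N => v /=; rewrite comp_lfunE g1E h1E linearZ /=.
  apply: cof_inj => -[|//] _; rewrite linearB /= !cofZ cof_eps //.
  by rewrite mulr1 mulrC subrr linear0.
by exists 0%N => v; rewrite [LHS]X2 [RHS]X2.
Qed.

(** * Gradings *)

Section DirectSum.

Variables (K : fieldType) (V : int -> vectType K) (W : vectType K).
Variable i : forall r, 'Hom(V r, W).
Hypothesis dsum : is_direct_sum i.

Lemma dsum_cover w : exists v : forall r, V r, exists s, w = \sum_(r <- s) i r (v r).
Proof.
have [s [_ _ [g _ gK]]] := dsum.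
by exists (g w), s; rewrite [RHS]gK.
Qed.

Lemma dsum_eq (W' : vectType K) (a b : 'Hom(W, W')) :
  (forall r v, a (i r v) = b (i r v)) -> a =1 b.
Proof.
move=> e w; have [v [s ->]] := dsum_cover w.
by rewrite !linear_sum; apply: eq_bigr => r _; apply: e.
Qed.

Lemma dsum_delta (s : seq int) (F : forall r, V r -> W) r (v : V r) :
    uniq s -> (forall r', F r' 0 = 0) -> (r \notin s -> v = 0) ->
  \sum_(r' <- s) F r' (dfwith (fun r' => 0 : V r') v r') = F r v.
Proof.
move=> us F0 v0; have [rs|rs] := boolP (r \in s); last first.
  rewrite v0 // F0 big1 // => r' _.
  by have [<-|rr'] := eqVneq r r'; rewrite ?dfwith_in ?dfwith_out.
rewrite (bigD1_seq r) //= dfwith_in big1 ?addr0 // => r' r'r.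
by rewrite dfwith_out ?F0 // eq_sym.
Qed.

Lemma dsum_out (s : seq int) r : (forall r, r \notin s -> \dim {: V r} = 0%N) ->
  r \notin s -> forall v : V r, v = 0.
Proof. by move=> V0 /V0 /dim_eq0P. Qed.

Lemma dsum_inj r v : i r v = 0 -> v = 0.
Proof.
have [s [us V0 [g gK _]]] := dsum => iv0.
have [rs|/dsum_out] := boolP (r \in s); last exact.
have /(congr1 (fun h => h r)) := gK (dfwith (fun r' => 0 : V r') v).
rewrite dfwith_in => <-.
have F0 r' : i r' 0 = 0 by exact: linear0.
rewrite (dsum_delta (F := fun r v => i r v) us F0) => [|/negP //].
have := gK (fun r => 0); rewrite big1 => [|r' _]; last by rewrite linear0.
by rewrite iv0 => ->.
Qed.

(** Endomorphisms of the summands add up to one of the direct sum; only the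
    inverse of the sum map is available, and it is shown to be linear. *)
Lemma dsum_endo (e : forall r, 'End(V r)) :
  exists p : 'End(W), forall r v, p (i r v) = i r (e r v).
Proof.
have [s [us V0 [g gK Kg]]] := dsum.
have g_lin a w w' : g (a *: w + w') = (fun r => a *: g w r + g w' r).
  rewrite -[RHS]gK; congr (g _); rewrite -{1}[w]Kg -{1}[w']Kg scaler_sumr -big_split /=.
  by apply: eq_bigr => r _; rewrite linearP.
have [p pE] : exists p : 'End(W), p =1 (fun w => \sum_(r <- s) i r (e r (g w r))).
  apply: linear_lfun => a w w'; rewrite g_lin scaler_sumr -big_split /=.
  by apply: eq_bigr => r _; rewrite !linearP.
exists p => r v; rewrite pE.
have -> : g (i r v) = dfwith (fun r' => 0 : V r') v.
  rewrite -[RHS]gK; congr (g _).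
  have F0 r' : i r' 0 = 0 by exact: linear0.
  by rewrite (dsum_delta (F := fun r v => i r v) us F0) // => rs; exact: (dsum_out V0).
have F0 r' : i r' (e r' 0) = 0 by rewrite !linear0.
by rewrite (dsum_delta (F := fun r v => i r (e r v)) us F0) // => rs; exact: (dsum_out V0).
Qed.

(** The finite set that supports a direct sum can be enlarged at will. *)
Lemma dsum_dim (s' : seq int) : exists s, [/\ uniq s, {subset s' <= s} &
  (\dim {: W} <= \sum_(r <- s) \dim {: V r})%N].
Proof.
have [s [us V0 [g gK Kg]]] := dsum.
exists (undup (s ++ s')); split; first exact: undup_uniq.
  by move=> r rs'; rewrite mem_undup mem_cat rs' orbT.
have sub : ({: W} <= \sum_(r <- undup (s ++ s')) limg (i r))%VS.
  apply/subvP => w _; rewrite -[w]Kg [X in X \in _]big_seq.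
  apply: rpred_sum => r rs; rewrite (big_rem r) /=; last by rewrite mem_undup mem_cat rs.
  by rewrite -[i r _]addr0 memv_add ?mem0v // memv_img ?memvf.
apply: leq_trans (dimvS sub) _; apply: leq_trans (dimv_leq_sum _ _ _) _.
apply: leq_sum => r _.
by rewrite -(leq_add2l (\dim (fullv :&: lker (i r)))) limg_ker_dim leq_addl.
Qed.

End DirectSum.

Section Pushdown.

Variable K : fieldType.
Implicit Types (X : crep K) (M : rep K).

Lemma pushdown_iso X M M' : riso M M' -> is_pushdown X M -> is_pushdown X M'.
Proof.
move=> [g1 [g2 [b1 b2 gf gl]]] [i [j [di dj fE lE]]].
have comp (V : int -> vectType K) (W W' : vectType K) (k : forall r, 'Hom(V r, W))
    (g : 'Hom(W, W')) : bijective g -> is_direct_sum k ->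
    is_direct_sum (fun r => g \o k r)%VF.
  move=> bg [s [us V0 bk]]; exists s; split=> //.
  apply: (eq_bij (bij_comp bg bk)) => v /=.
  by rewrite linear_sum; apply: eq_bigr => r _; rewrite comp_lfunE.
exists (fun r => g1 \o i r)%VF, (fun r => g2 \o j r)%VF.
by split=> [||r x|r x]; try exact: comp; rewrite !comp_lfunE ?(gf, gl) -?gf -?gl ?fE ?lE.
Qed.

Lemma pushdown_bound X M : rbound M -> is_pushdown X M -> cbound X.
Proof.
move=> Mb [i [j [_ dj _ lE]]] r x; apply: (dsum_inj dj).
by rewrite -!lE Mb.
Qed.

Lemma dsum_zero (V : int -> vectType K) (W : vectType K) (k : forall r, 'Hom(V r, W)) :
  is_direct_sum k -> (forall r, \dim {: V r} = 0%N) -> forall w : W, w = 0.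
Proof.
move=> dk V0 w; have [v [s ->]] := dsum_cover dk w; apply: big1 => r _.
have /dim_eq0P z := V0 r; by rewrite (z (v r)) linear0.
Qed.

(** The projections onto a summand A of X, row by row, add up to an idempotent
    endomorphism of M. *)
Lemma pushdown_cindec X M :
  rlocal M -> ~ rzero M -> is_pushdown X M -> cindec X.
Proof.
move=> Mloc M0 [i [j [di dj fE lE]]]; split=> [X0|A B [g [h [bg bh gf hl]]]].
  apply: M0; apply/rzeroP; split; [apply: (dsum_zero di)|apply: (dsum_zero dj)] => r;
  by case: (X0 r).
(* The projections onto A, transported to X. *)
pose pg r : 'End(clsp X r) := ((g r)^-1 \o hom_pair \1 0 \o g r)%VF.
pose ph r : 'End(ctsp X r) := ((h r)^-1 \o hom_pair \1 0 \o h r)%VF.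
have gK r := bij_lfun_inverse (bg r); have hK r := bij_lfun_inverse (bh r).
have gp r v : g r (pg r v) = ((g r v).1, 0).
  by rewrite !comp_lfunE (gK r).2 hom_pairE !lfunE.
have hp r v : h r (ph r v) = ((h r v).1, 0).
  by rewrite !comp_lfunE (hK r).2 hom_pairE !lfunE.
have [p1 p1E] := dsum_endo di pg; have [p2 p2E] := dsum_endo dj ph.
have pM : @rhom _ M M p1 p2.
  split=> x; rewrite -[LHS]comp_lfunE -[RHS]comp_lfunE.
    apply: (dsum_eq di) => r v; rewrite !comp_lfunE fE p1E p2E fE; congr (j r _).
    by apply: (can_inj (hK r).1); rewrite hp !gf gp /= !hom_pairE /= linear0.
  apply: (dsum_eq dj) => r v; rewrite !comp_lfunE lE !p2E lE; congr (j _ _).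
  by apply: (can_inj (hK (r + 1)).1); rewrite hp !hl hp /= !hom_pairE /= linear0.
have i1 x : p1 (p1 x) = p1 x.
  rewrite -[LHS]comp_lfunE; apply: (dsum_eq di) => r v.
  by rewrite comp_lfunE !p1E; congr (i r _); apply: (can_inj (gK r).1); rewrite !gp.
have i2 x : p2 (p2 x) = p2 x.
  rewrite -[LHS]comp_lfunE; apply: (dsum_eq dj) => r v.
  by rewrite comp_lfunE !p2E; congr (j r _); apply: (can_inj (hK r).1); rewrite !hp.
have [c [u1 u2]] := Mloc _ _ pM.
have [c1|c1] := eqVneq c 1; [right|left] => r.
  have c0 : c != 0 by rewrite c1 oner_neq0.
  split; apply/dim_eq0P => b.
    have := sole_eigenvalue_idem1 u1 i1 c0 (i r ((g r)^-1%VF (0, b))); rewrite p1E => /eqP.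
    rewrite -subr_eq0 -linearB => /eqP/(dsum_inj di)/eqP; rewrite subr_eq0 => /eqP/(congr1 (g r)).
    by rewrite gp (gK r).2 => -[].
  have := sole_eigenvalue_idem1 u2 i2 c0 (j r ((h r)^-1%VF (0, b))); rewrite p2E => /eqP.
  rewrite -subr_eq0 -linearB => /eqP/(dsum_inj dj)/eqP; rewrite subr_eq0 => /eqP/(congr1 (h r)).
  by rewrite hp (hK r).2 => -[].
split; apply/dim_eq0P => b.
  have := sole_eigenvalue_idem0 u1 i1 c1 (i r ((g r)^-1%VF (b, 0))); rewrite p1E.
  by move/(dsum_inj di)/(congr1 (g r)); rewrite gp (gK r).2 linear0 => -[].
have := sole_eigenvalue_idem0 u2 i2 c1 (j r ((h r)^-1%VF (b, 0))); rewrite p2E.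
by move/(dsum_inj dj)/(congr1 (h r)); rewrite hp (hK r).2 linear0 => -[].
Qed.

End Pushdown.

Section Diagonal.

Variable K : fieldType.

Definition diag_end n (d : nat -> K) : 'End('cV[K]_n) :=
  linfun (mulmx (diag_mx (\row_(a < n) d a))).

Lemma diag_endE n d a (v : 'cV[K]_n) : cof a (diag_end n d v) = d a * cof a v :> K.
Proof.
have [an|an] := ltnP a n; last by rewrite !cof_out // mulr0.
by rewrite -[a]/(nat_of_ord (Ordinal an)) !cof_ord lfunE /= mul_diag_mx !mxE.
Qed.

Lemma diag_end_arr u d v :
  rarr (model_rep K u) (diag_end (msrc u) d v) = diag_end (mtgt u) d (rarr (model_rep K u) v).
Proof.
by apply: cof_inj => a /= aN; rewrite model_arrE // !diag_endE model_arrE.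
Qed.

(** The loop raises degrees by one. *)
Lemma diag_end_loop u d d' v : model_ok u ->
    (forall b, d (mdegree u b).+1 = d' (mdegree u b)) ->
  rloop (model_rep K u) (diag_end (mtgt u) (d' \o mdegree u) v) =
  diag_end (mtgt u) (d \o mdegree u) (rloop (model_rep K u) v).
Proof.
move=> uok dd; apply: cof_inj => a /= aN; rewrite diag_endE !model_loopE // /mrow /feval.
rewrite !big_map mulr_sumr !big_filter big_seq_cond [RHS]big_seq_cond.
apply: eq_bigr => p /andP[/(mloopP uok)[_ _ dp] /eqP pa].
by rewrite diag_endE /= -dd -dp pa mulrzAr.
Qed.

End Diagonal.

(** An eigenvector of D for x is determined by its coordinates at the places
    where the diagonal is x: if these are zero, then so is its part of lowest
    degree. *)
Lemma triangular_eigen_dim (K : fieldType) n (V : vectType K) (i : 'Hom(V, 'cV[K]_n))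
    (D : 'End('cV[K]_n)) deg d x :
  (forall v, i v = 0 -> v = 0) -> (forall v, D (i v) = x *: i v) ->
  triangular deg d D -> (\dim {: V} <= #|[pred a : 'I_n | d a == x]|)%N.
Proof.
move=> i_inj Di tri; set A := [pred a | _].
have [g gE] : exists g : 'Hom(V, 'rV[K]_#|A|), g =1 (fun v => \row_t i v (enum_val t) 0).
  by apply: linear_lfun => c v v'; apply/rowP => t; rewrite !linearP !mxE.
have ker0 : (fullv :&: lker g = 0)%VS.
  apply/eqP; rewrite capfv -subv0; apply/subvP => v; rewrite memv_ker memv0 gE => /eqP gv.
  apply/eqP/i_inj/cof_inj => a an; rewrite linear0.
  have [m] := ubnP (deg a); elim: m => // m IH in a an * => am.
  have [ax|ax] := eqVneq (d a) x.
    have aA : Ordinal an \in A by rewrite inE ax.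
    move/rowP/(_ (enum_rank_in aA (Ordinal an))): gv.
    by rewrite !mxE enum_rankK_in // -cof_ord.
  have := congr1 (cof a) (Di v); rewrite cofZ cof_map.
  rewrite (bigD1 (Ordinal an)) //= tri // eqxx mulr1n big1 => [|b ba].
    rewrite addr0 mulrC => /eqP; rewrite -subr_eq0 -mulrBl mulf_eq0 subr_eq0 (negPf ax).
    by move/eqP.
  have [ab|ba'] := leqP (deg a) (deg b); last by rewrite IH ?mul0r // (leq_trans ba').
  by rewrite tri // -[a]/(nat_of_ord (Ordinal an)) val_eqE eq_sym (negPf ba) mulr0.
rewrite -(limg_dim_eq ker0) (leq_trans (dimvS (subvf _))) //.
by rewrite dimvf /dim /= mul1n.
Qed.

Section GradingDim.

Variable K : numFieldType.

(** If V_r is the eigenspace of D for r, then dim V_r is at most the number of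
    diagonal entries equal to r.  As the V_r span the whole space, all these
    inequalities are equalities and the diagonal consists of integers. *)
Lemma dsum_eigen_dim n (V : int -> vectType K) (i : forall r, 'Hom(V r, 'cV[K]_n))
    (D : 'End('cV[K]_n)) deg (d : nat -> K) :
  is_direct_sum i -> (forall r v, D (i r v) = r%:~R *: i r v) -> triangular deg d D ->
  (forall r, \dim {: V r} = #|[pred a : 'I_n | d a == r%:~R]|) /\
  (forall a, (a < n)%N -> exists r : int, d a = r%:~R).
Proof.
move=> ds Di tri; pose N (r : int) := #|[pred a : 'I_n | d a == r%:~R]|.
have le r : (\dim {: V r} <= N r)%N.
  by apply: (triangular_eigen_dim (@dsum_inj _ _ _ _ ds r) (Di r) tri).
have cover (s' : seq int) : exists s : seq int, [/\ {subset s' <= s},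
    forall r, r \in s -> \dim {: V r} = N r &
    forall a : 'I_n, has (fun r : int => d a == r%:~R) s].
  have [s [us ss' dims]] := dsum_dim ds s'; exists s.
  (* Distinct integers stay distinct in K, so a diagonal entry is counted once at most. *)
  have NE : (\sum_(r <- s) N r = \sum_(a < n) has (fun r : int => d a == r%:~R) s)%N.
    rewrite /N; under eq_bigr => r _ do rewrite -sum1_card big_mkcond /=.
    rewrite exchange_big; apply: eq_bigr => a _ /=.
    elim: s us {ss' dims} => [|r s IH] /= => [_|/andP[rs us]]; first by rewrite big_nil.
    rewrite big_cons IH // inE; case: (d a =P r%:~R) => [dr|_] //=.
    suff /negbTE -> : ~~ has (fun r : int => d a == r%:~R) s by [].
    apply/hasPn => r' r's; rewrite dr eqr_int.
    by apply: contraNneq rs => ->.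
  have Nn : (\sum_(r <- s) N r <= n)%N.
    rewrite NE -[X in (_ <= X)%N]card_ord -sum1_card; apply: leq_sum => a _.
    exact: leq_b1.
  have nD : (n <= \sum_(r <- s) \dim {: V r})%N.
    by apply: leq_trans dims; rewrite dimvf /dim /= muln1.
  have DN : (\sum_(r <- s) \dim {: V r} <= \sum_(r <- s) N r)%N by apply: leq_sum.
  split=> // [r rs|a].
    apply/eqP; rewrite eqn_leq le /= leqNgt; apply: contraL (leq_trans Nn nD) => lt.
    rewrite -ltnNge (big_rem r rs) [X in (_ < X)%N](big_rem r rs) /= -addSn.
    by apply: leq_add => //; apply: leq_sum.
  have: (n <= \sum_(a < n) has (fun r : int => d a == r%:~R) s)%N.
    by rewrite -NE (leq_trans nD).
  rewrite (bigD1 a) //=; case: (has _ _) => //.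
  apply: contraLR => _; rewrite add0n -ltnNge.
  rewrite -[X in (_ < X)%N]card_ord -sum1_card [X in (_ < X)%N](bigD1 a) //= add1n ltnS.
  by apply: leq_sum => b _; apply: leq_b1.
split=> [r|a an].
  have [s [ss e _]] := cover [:: r]; apply: e; apply: ss; exact: mem_head.
have [s [_ _ /(_ (Ordinal an)) /hasP[r _ /eqP dr]]] := cover [::].
by exists r.
Qed.

Lemma count_take (p : pred nat) n s : (n <= size s)%N ->
  count p (take n s) = #|[pred a : 'I_n | p (nth 0%N s a)]|.
Proof.
move=> ns; rewrite -(map_nth_iota0 0%N ns) count_map -val_enum_ord count_map.
by rewrite cardE size_filter enumT; apply: eq_count.
Qed.

Lemma model_dimvecE u (k : nat) : model_ok u -> nth (0, 0)%N (model_dimvec u) k =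
  (#|[pred a : 'I_(msrc u) | mdegree u a == k]|,
   #|[pred a : 'I_(mtgt u) | mdegree u a == k]|)%N.
Proof.
move=> uok; have /and5P[_ _ /eqP sz _ _] := uok.
have e n : (n <= mdim u)%N ->
    #|[pred a : 'I_n | mdegree u a == k]| = count (pred1 k) (take n (mdeg u)).
  by move=> nd; rewrite (count_take _ (n := n)) ?sz.
rewrite !e ?leq_maxl ?leq_maxr // /model_dimvec.
have [kL|kL] := ltnP k (foldr maxn 0%N (mdeg u)).+1; first by rewrite nth_mkseq.
rewrite nth_default ?size_mkseq //.
have no n : count (pred1 k) (take n (mdeg u)) = 0%N.
  apply/count_memPn; apply/negP => /mem_take; move: kL; elim: (mdeg u) => //= x s IH.
  rewrite gtn_max inE => /andP[xk sk] /orP[/eqP kx|]; last exact: IH.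
  by rewrite kx ltnn in xk.
by rewrite !no.
Qed.

(** Both the grading of U by X and the standard grading define operators D with
    D f = f D and D N = N D + N.  Their difference is an endomorphism, so the
    former is triangular with diagonal [mdegree] + c, and the dimensions of its
    eigenspaces are those of the standard grading shifted by c. *)
Lemma pushdown_dimvec u s X : model_ok u -> brick_ok u s ->
  is_pushdown X (model_rep K u) -> has_dimvec X (model_dimvec u).
Proof.
move=> uok bok [i [j [di dj fE lE]]].
have [D1 D1E] := dsum_endo di (fun r => r%:~R *: \1)%VF.
have [D2 D2E] := dsum_endo dj (fun r => r%:~R *: \1)%VF.
have {}D1E r v : D1 (i r v) = r%:~R *: i r v.
  by rewrite D1E scale_lfunE id_lfunE; exact: linearZ.
have {}D2E r v : D2 (j r v) = r%:~R *: j r v.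
  rewrite D2E scale_lfunE id_lfunE; exact: linearZ.
pose d a : K := (mdegree u a)%:R.
pose e1 := (D1 - diag_end _ d)%VF; pose e2 := (D2 - diag_end _ d)%VF.
have e1E v : e1 v = D1 v - diag_end _ d v by rewrite add_lfunE opp_lfunE.
have e2E v : e2 v = D2 v - diag_end _ d v by rewrite add_lfunE opp_lfunE.
clearbody e1 e2.
have eU : @rhom _ (model_rep K u) (model_rep K u) e1 e2.
  split=> x.
    rewrite e1E e2E linearB; congr (_ - _); last exact/esym/diag_end_arr.
    rewrite -[LHS]comp_lfunE -[RHS]comp_lfunE; apply: (dsum_eq di) => r v.
    by rewrite !comp_lfunE D1E fE D2E -fE linearZ.
  (* Both gradings make N homogeneous of degree one: D N = N D + N. *)
  have D2l : D2 (rloop (model_rep K u) x) =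
      rloop (model_rep K u) (D2 x) + rloop (model_rep K u) x.
    have [M ME] : exists M : 'End(rsp2 (model_rep K u)), M =1 (fun x =>
       rloop (model_rep K u) (D2 x) + rloop (model_rep K u) x).
      by apply: linear_lfun => a y z; rewrite !linearP /= scalerDr addrACA.
    rewrite -[LHS]comp_lfunE -ME; apply: (dsum_eq dj) => r v.
    by rewrite comp_lfunE ME D2E lE D2E rmorphD /= scalerDl scale1r linearZ -lE.
  have dl : diag_end _ d (rloop (model_rep K u) x) =
      rloop (model_rep K u) (diag_end _ d x) + rloop (model_rep K u) x.
    rewrite -(@diag_end_loop K u (fun k => k%:R) (fun k => k.+1%:R)) // -linearD.
    apply: (congr1 (rloop (model_rep K u))).
    by apply: cof_inj => a _; rewrite linearD /= !diag_endE /= -natr1 mulrDl mul1r.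
  by rewrite !e2E linearB D2l dl opprD addrACA subrr addr0.
have [c [t1 t2 _]] := brick_endo uok bok eU.
pose dc a : K := d a + c.
have tri n (D e : 'End('cV[K]_n)) : (forall v, e v = D v - diag_end _ d v) ->
    triangular (mdegree u) (fun=> c) e -> triangular (mdegree u) dc D.
  move=> eE te a b an bn ab; have := te a b an bn ab.
  rewrite eE linearB /= diag_endE cof_eps // => /(canRL (subrK _)) ->.
  by rewrite /dc mulr_natr -mulrnDl addrC.
have [dim1 in1] := dsum_eigen_dim di D1E (tri _ _ _ e1E t1).
have [dim2 in2] := dsum_eigen_dim dj D2E (tri _ _ _ e2E t2).
have [m cm] : exists m : int, c = m%:~R.
  have /and5P[_ + _ _ _] := uok; rewrite leq_max => /orP[m0|m0].
    have [r] := in1 _ m0; rewrite /dc /d => /(canRL (addKr _)) ->.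
    by exists (- (mdegree u 0)%:Z + r); rewrite rmorphD rmorphN.
  have [r] := in2 _ m0; rewrite /dc /d => /(canRL (addKr _)) ->.
  by exists (- (mdegree u 0)%:Z + r); rewrite rmorphD rmorphN.
have dcE a r : (dc a == r%:~R) = ((mdegree u a)%:Z + m == r).
  by rewrite /dc /d cm -[(mdegree u a)%:R]/((mdegree u a)%:Z%:~R) -rmorphD eqr_int.
exists m; split=> [k|r rm].
  rewrite model_dimvecE // /crow dim1 dim2; congr (_, _); apply: eq_card => a.
    by rewrite !inE dcE addrC (inj_eq (addrI m)).
  by rewrite !inE dcE addrC (inj_eq (addrI m)).
rewrite /crow dim1 dim2; congr (_, _); apply: eq_card0 => a.
  by rewrite !inE dcE; apply/negbTE/eqP => e; move: rm; rewrite -e gtrDr.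
by rewrite !inE dcE; apply/negbTE/eqP => e; move: rm; rewrite -e gtrDr.
Qed.

End GradingDim.

(** * The representation of the covering *)

Section Covering.

Variables (K : fieldType) (u : model).
Hypothesis uok : model_ok u.

(** Indicator of the basis vectors of degree [r]. *)
Definition in_layer (r : int) (a : nat) : K := ((mdegree u a)%:Z == r)%:R.

Definition layer n (r : int) : {vspace 'cV[K]_n} := limg (diag_end n (in_layer r)).

Lemma layerP n r (v : 'cV[K]_n) : reflect (diag_end n (in_layer r) v = v) (v \in layer n r).
Proof.
apply: (iffP idP) => [/memv_imgP[w _ ->]|<-]; last by rewrite memv_img ?memvf.
apply: cof_inj => a _; rewrite !diag_endE mulrA /in_layer; case: eqP => _.
  by rewrite mul1r.
by rewrite mul0r.
Qed.

Definition restrict n m (g : 'Hom('cV[K]_n, 'cV[K]_m)) (r r' : int) :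
    'Hom(subvs_of (layer n r), subvs_of (layer m r')) :=
  (linfun (vsproj (layer m r')) \o g \o linfun (@vsval _ _ (layer n r)))%VF.

Lemma restrictE n m (g : 'Hom('cV[K]_n, 'cV[K]_m)) r r' x :
    (forall v, g (diag_end n (in_layer r) v) = diag_end m (in_layer r') (g v)) ->
  vsval (restrict g r r' x) = g (vsval x).
Proof.
move=> gr; rewrite !comp_lfunE !lfunE /= vsprojK //.
by apply/layerP; rewrite -gr; congr (fun_of_lfun g _); apply/layerP/subvsP.
Qed.

(** The representation [u] cut into its homogeneous parts. *)
Definition covering_rep : crep K :=
  @CRep K (fun r => subvs_of (layer (msrc u) r)) (fun r => subvs_of (layer (mtgt u) r))
    (fun r => restrict (rarr (model_rep K u)) r r)
    (fun r => restrict (rloop (model_rep K u)) r (r + 1)).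

Lemma lvalE n r (x : subvs_of (layer n r)) :
  linfun (@vsval _ _ (layer n r)) x = vsval x.
Proof. by rewrite lfunE. Qed.

Lemma layer_direct_sum n :
  is_direct_sum (fun r => linfun (@vsval _ _ (layer n r))).
Proof.
pose s := undup [seq (mdegree u a)%:Z | a <- iota 0 n]; exists s.
have ds a : (a < n)%N -> (mdegree u a)%:Z \in s.
  by move=> an; rewrite mem_undup map_f // mem_iota.
have zero r : r \notin s -> forall v : subvs_of (layer n r), v = 0.
  move=> rs v; apply/val_inj/cof_inj => a an /=; rewrite linear0.
  have /layerP <- := subvsP v; rewrite diag_endE /in_layer; case: eqP => [ar|_].
    by rewrite -ar ds in rs.
  by rewrite mul0r.
have orth r r' (x : subvs_of (layer n r')) : r' != r -> diag_end n (in_layer r) (vsval x) = 0.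
  move=> r'r; apply: cof_inj => a _; have /layerP <- := subvsP x.
  rewrite !diag_endE linear0 mulrA /in_layer; case: eqP => [->|_]; last by rewrite !mul0r.
  by rewrite eq_sym (negPf r'r) mulr0 mul0r.
split; [exact: undup_uniq|by move=> r rs; apply/dim_eq0P/zero|].
exists (fun w r => vsproj (layer n r) (diag_end n (in_layer r) w)) => [v|w].
  apply: functional_extensionality_dep => r; apply/val_inj.
  rewrite /= vsprojK; last by rewrite memv_img ?memvf.
  rewrite linear_sum; under eq_bigr => r' _ do rewrite lfunE /=.
  have [rs|rs] := boolP (r \in s); last first.
    rewrite (zero r rs (v r)) [RHS]linear0 big_seq big1 // => r' r's; apply: orth.
    by apply: contraNneq rs => <-.
  rewrite (bigD1_seq r) ?undup_uniq //= big1 => [|r' r'r]; last exact: orth.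
  by rewrite addr0; apply/layerP/subvsP.
apply: cof_inj => a an; rewrite linear_sum /=.
under eq_bigr => r _ do rewrite lfunE /= vsprojK ?memv_img ?memvf // diag_endE.
rewrite (bigD1_seq (mdegree u a)%:Z) ?undup_uniq ?ds //= /in_layer eqxx mul1r.
rewrite big1 ?addr0 // => r; rewrite eq_sym => /negPf ->; exact: mul0r.
Qed.

Lemma covering_pushdown : is_pushdown covering_rep (model_rep K u).
Proof.
exists (fun r => linfun (@vsval _ _ (layer (msrc u) r))),
       (fun r => linfun (@vsval _ _ (layer (mtgt u) r))).
split; try exact: layer_direct_sum; move=> r x.
  rewrite !lvalE restrictE // => v.
  exact: diag_end_arr.
rewrite !lvalE restrictE // => v.
apply: (diag_end_loop (d := fun a => (a%:Z == r + 1)%:R) (d' := fun a => (a%:Z == r)%:R)) => // b.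
by rewrite -addn1 PoszD (inj_eq (addIr 1)).
Qed.

End Covering.

(** * The correspondence with the covering *)

Section Correspondence.

Variables (K : fieldType) (u : model) (s : almost_split).
Hypotheses (uok : model_ok u) (bok : brick_ok u s).

Lemma brick_local : rlocal (model_rep K u).
Proof.
move=> e1 e2 /(brick_endo uok bok)[c [t1 t2 _]].
by exists c; split; apply: triangular_sole_eigenvalue; [exact: t1|exact: t2].
Qed.

Lemma brick_indec : rindec (model_rep K u).
Proof. exact: (local_indec (model_nonzero uok) brick_local). Qed.

Lemma covering_corresponds : corresponds (covering_rep K u) (model_rep K u).
Proof.
have pd := covering_pushdown K uok; split=> //.
  exact: pushdown_bound (model_bound uok) pd.
exact: pushdown_cindec brick_local (model_nonzero uok) pd.
Qed.

End Correspondence.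

(** The first nonzero row of X fixes the shift. *)
Lemma has_dimvec_inj (K : fieldType) (X : crep K) (s s' : seq (nat * nat)) :
    s != [::] -> s' != [::] -> (0, 0)%N \notin s -> (0, 0)%N \notin s' ->
  has_dimvec X s -> has_dimvec X s' -> s = s'.
Proof.
have nth_neq0 (l : seq (nat * nat)) k : (0, 0)%N \notin l ->
    (k < size l)%N = (nth (0, 0)%N l k != (0, 0)%N).
  move=> l0; have [kl|kl] := ltnP k (size l); last by rewrite nth_default.
  by apply/esym; apply: contraNneq l0 => <-; rewrite mem_nth.
have head_neq0 (l : seq (nat * nat)) : l != [::] -> (0, 0)%N \notin l ->
    nth (0, 0)%N l 0 != (0, 0)%N.
  by move=> l_n l0; rewrite -nth_neq0 // lt0n size_eq0.
move=> s_n s'_n s0 s'0 [m [ms mlt]] [m' [m's m'lt]].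
have mm' : m = m'.
  apply/eqP; case: ltgtP => // lt.
    by have := head_neq0 _ s_n s0; rewrite -ms addr0 m'lt // eqxx.
  by have := head_neq0 _ s'_n s'0; rewrite -m's addr0 mlt // eqxx.
have e k : nth (0, 0)%N s k = nth (0, 0)%N s' k by rewrite -ms -m's mm'.
apply: (@eq_from_nth _ (0, 0)%N) => // .
have lt k : (k < size s)%N = (k < size s')%N by rewrite !nth_neq0 // e.
by apply/eqP; rewrite eqn_leq [X in X && _]leqNgt [X in _ && X]leqNgt lt ltnn -lt ltnn.
Qed.

Lemma model_itemE (K : fieldType) (u : model) (dv : seq (nat * nat)) (N : 'M[K]_(mtgt u)) :
  model_dimvec u = dv ->
  \sum_(t <- mloop u) t.2%:~R *: E t.1.1.+1 t.1.2.+1 = N ->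
  model_item K u = Item (msrc u) (mtgt u) dv N.
Proof. by rewrite /model_item => -> ->. Qed.

Lemma Ulist_models (K : fieldType) : [seq model_item K u | u <- models] = Ulist K.
Proof.
rewrite /models /Ulist [RHS]/=.
do 30! [apply: (congr2 cons);
  first by apply: model_itemE => //;
    rewrite unlock /= ?scale1r ?scaleN1r ?addr0 ?addrA].
by [].
Qed.

(** * Dimension vectors and isomorphism classes *)

Lemma models_okP k : (k < size models)%N ->
  model_ok (nmodel models k) /\ brick_ok (nmodel models k) (nsplit almost_splits k).
Proof.
by move=> kn; have /allP/(_ k) := models_ok; rewrite mem_iota => /(_ kn)/and3P[].
Qed.

Lemma item_model (K : fieldType) (k : 'I_30) :
  tnth (Ulist K) k = model_item K (nmodel models k).
Proof.
by rewrite (tnth_nth (model_item K model0)) -Ulist_models (nth_map model0) ?ltn_ord.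
Qed.

Lemma dimvecs_distinct : uniq (map model_dimvec models).
Proof. exact: erefl. Qed.

Lemma dimvecs_normal :
  all (fun s => (s != [::]) && ((0, 0)%N \notin s)) (map model_dimvec models).
Proof. exact: erefl. Qed.

Section Main.

Variable K : numFieldType.

Lemma U_dimvec (k : 'I_30) X : is_pushdown X (U K k) -> has_dimvec X (Udimvec K k).
Proof.
have [uok bok] := models_okP (ltn_ord k).
by rewrite /U /Udimvec item_model; apply: pushdown_dimvec uok bok.
Qed.

(** A covering representation of U_k is one of U_l as well, so both have the
    dimension vector of that representation. *)
Lemma U_riso (k l : 'I_30) : riso (U K k) (U K l) -> k = l.
Proof.
have [uok bok] := models_okP (ltn_ord k).
move=> iso; have pk : is_pushdown (covering_rep K (nmodel models k)) (U K k).
  by rewrite /U item_model; apply: covering_pushdown.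
have := U_dimvec pk; have := U_dimvec (pushdown_iso iso pk).
rewrite /Udimvec !item_model /= => dl dk; apply/val_inj/eqP.
rewrite -(nth_uniq [::] _ _ dimvecs_distinct) ?size_map ?ltn_ord //.
rewrite !(nth_map model0) ?ltn_ord //.
have norm (j : 'I_30) : (model_dimvec (nmodel models j) != [::]) &&
    ((0, 0)%N \notin model_dimvec (nmodel models j)).
  have /(all_nthP [::])/(_ j) := dimvecs_normal.
  by rewrite size_map (nth_map model0) ?ltn_ord //; apply.
have /andP[? ?] := norm k; have /andP[? ?] := norm l.
by apply/eqP; apply: has_dimvec_inj dk dl.
Qed.

End Main.

Theorem proposition6p1 (R : realType) :
  [/\ forall k : 'I_30, rbound (U R[i] k) /\ rindec (U R[i] k),
      forall k l : 'I_30, riso (U R[i] k) (U R[i] l) -> k = l,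
      forall M : rep R[i], rbound M -> rindec M ->
        exists k : 'I_30, riso M (U R[i] k)
    & forall k : 'I_30,
        (exists X : crep R[i], corresponds X (U R[i] k)) /\
        (forall X : crep R[i], corresponds X (U R[i] k) ->
           has_dimvec X (Udimvec R[i] k))].
Proof.
split=> [k|k l|M Mb Mi|k].
- have [uok bok] := models_okP (ltn_ord k); rewrite /U item_model.
  by split; [apply: (model_bound uok)|apply: brick_indec uok bok].
- exact: U_riso.
- have [k kn iso] := classification Mb Mi.
  by exists (Ordinal kn); rewrite /U item_model.
- have [uok bok] := models_okP (ltn_ord k).
  split=> [|X [_ _ pX]]; last exact: U_dimvec.
  exists (covering_rep R[i] (nmodel models k)); rewrite /U item_model.
  exact: covering_corresponds uok bok.
Qed.
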